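(* Let $(G,Y)$ be a finite, connected, non-empty graph of finitely generated groups with finite edge groups (that is, $Y$ is a finite connected non-empty graph, every vertex group $G_v$ is finitely generated and every edge group $G_y$ is finite). Then the fundamental group of $(G,Y)$ has decidable rational subset problem if and only if every vertex group has decidable rational subset problem. Moreover, the equivalence is effective.
   Context: Rational subsets. A finite automaton over a finitely generated monoid $M$ is a finite directed graph with edges labelled by elements of $M$, with a distinguished initial vertex and a set of distinguished terminal vertices; the subset it recognises is the set of all elements of $M$ labelling paths (labels multiplied along the path) from the initial vertex to some terminal vertex. A subset of $M$ is rational if it is recognised by some finite automaton over $M$. A finitely generated monoid (or group) $M$ has decidable rational subset problem if there is an algorithm which, given a finite automaton over $M$ (edge labels given as words over a fixed finite monoid generating set) and an element $m\in M$ (given as a word over the generating set), decides whether $m$ lies in the subset recognised; this does not depend on the choice of finite generating set. Graphs of groups. $Y$ is a finite directed graph, possibly with loops and multiple edges, with vertex set $V(Y)$, edge set $E(Y)$, and functions $\alpha,\omega:E(Y)\to V(Y)$ (written on the right) taking each edge to its start and its end, together with a fixed-point-free involution $y\mapsto\overline{y}$ on $E(Y)$ such that $y\alpha=\overline{y}\omega$ for all $y$. A graph of groups $(G,Y)$ consists of a group $G_v$ for each $v\in V(Y)$; a group $G_y$ for each $y\in E(Y)$ with $G_y=G_{\overline{y}}$; and, for each $y\in E(Y)$, injective morphisms $\alpha_y:G_y\to G_{y\alpha}$ and $\omega_y:G_y\to G_{y\omega}$ with $\alpha_y=\omega_{\overline{y}}$. The vertex groups are assumed to intersect only in the identity and to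 be disjoint from $E(Y)$. Let $\langle X_v\mid R_v\rangle$ be a monoid presentation of $G_v$, with the sets $X_v$ pairwise disjoint, and let $B$ be the disjoint union of $E(Y)$ and all the $X_v$. The group $F(G,Y)$ is given by the monoid presentation with generators $B$ and relations $R_v$ ($v\in V(Y)$), $y\overline{y}=1$ ($y\in E(Y)$), and $y(g\omega_y)\overline{y}=g\alpha_y$ ($y\in E(Y)$, $g\in G_y$). For a fixed vertex $v_0$, a word in $B^*$ is of cycle type at $v_0$ if it has the form $w_0y_1w_1y_2w_2\cdots y_nw_n$ with each $y_i\in E(Y)$, $y_1\cdots y_n$ a path in $Y$ starting and ending at $v_0$, $w_0\in X_{v_0}^*$ and $w_i\in X_{y_i\omega}^*$ for $1\le i\le n$. The images in $F(G,Y)$ of the words of cycle type at $v_0$ form a subgroup $\pi_1(G,Y,v_0)$, the fundamental group of $(G,Y)$ at $v_0$; for connected $Y$ it is independent of $v_0$ up to isomorphism. ''The equivalence is effective'' means that an algorithm solving the rational subset problem for the fundamental group can be effectively computed from algorithms for the vertex groups, and vice versa. *)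

(* Defs.v *)
From HB Require Import structures.
From mathcomp Require Import all_boot all_fingroup.
From mathcomp Require Import boolp.

Set Implicit Arguments.
Unset Strict Implicit.
Unset Printing Implicit Defensive.

Local Open Scope group_scope.
Local Open Scope quotient_scope.

(* The model of computation is (a point-free form of) Jones's WHILE language
   over binary trees, which is Turing complete.  The classical axioms make every
   predicate decidable by a Rocq function to [bool], so an explicit model is
   needed for "there is an algorithm" to have any content. *)
Inductive data : Type := DNil | DCons of data & data.

Inductive prog : Type :=
  | PId
  | PQuote of data
  | PHd
  | PTl
  | PCons of prog & prog
  | PComp of prog & prog
  | PIf of prog & prog & prog
  | PWhile of prog & prog.

Definition hd_data (d : data) : data := if d is DCons a _ then a else DNil.
Definition tl_data (d : data) : data := if d is DCons _ b then b else DNil.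

(* [eval p d e]: the program [p] halts on the input [d] with output [e].  In
   tests, [DNil] stands for false and every other tree for true. *)
Inductive eval : prog -> data -> data -> Prop :=
  | ev_id d : eval PId d d
  | ev_quote c d : eval (PQuote c) d c
  | ev_hd d : eval PHd d (hd_data d)
  | ev_tl d : eval PTl d (tl_data d)
  | ev_cons p q d a b :
      eval p d a -> eval q d b -> eval (PCons p q) d (DCons a b)
  | ev_comp p q d e f : eval q d e -> eval p e f -> eval (PComp p q) d f
  | ev_if_true b p q d t1 t2 e :
      eval b d (DCons t1 t2) -> eval p d e -> eval (PIf b p q) d e
  | ev_if_false b p q d e : eval b d DNil -> eval q d e -> eval (PIf b p q) d e
  | ev_while_true b p d t1 t2 e f :
      eval b d (DCons t1 t2) -> eval p d e -> eval (PWhile b p) e f ->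
      eval (PWhile b p) d f
  | ev_while_false b p d : eval b d DNil -> eval (PWhile b p) d d.

Fixpoint enc_nat (n : nat) : data := if n is k.+1 then DCons DNil (enc_nat k) else DNil.

Definition enc_bool (b : bool) : data := if b then DCons DNil DNil else DNil.

Definition enc_seq (T : Type) (enc : T -> data) (s : seq T) : data :=
  foldr (fun x d => DCons (enc x) d) DNil s.

Definition enc_fin (T : finType) (x : T) : data := enc_nat (enum_rank x).

Definition enc_word (A : finType) (w : seq A) : data := enc_seq (@enc_fin A) w.

Fixpoint code (p : prog) : data :=
  match p with
  | PId => DCons (enc_nat 0) DNil
  | PQuote d => DCons (enc_nat 1) d
  | PHd => DCons (enc_nat 2) DNil
  | PTl => DCons (enc_nat 3) DNil
  | PCons p q => DCons (enc_nat 4) (DCons (code p) (code q))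
  | PComp p q => DCons (enc_nat 5) (DCons (code p) (code q))
  | PIf b p q => DCons (enc_nat 6) (DCons (code b) (DCons (code p) (code q)))
  | PWhile b p => DCons (enc_nat 7) (DCons (code b) (code p))
  end.

Record automaton (L : eqType) := Automaton {
  aut_size : nat;
  aut_init : 'I_aut_size;
  aut_term : {set 'I_aut_size};
  aut_edges : seq ('I_aut_size * L * 'I_aut_size)
}.

(* [aut_path N p ls q]: [ls] is the sequence of labels along a path from [p] to
   [q]. *)
Inductive aut_path (L : eqType) (N : automaton L) :
    'I_(aut_size N) -> seq L -> 'I_(aut_size N) -> Prop :=
  | aut_path_nil p : aut_path p [::] p
  | aut_path_cons p l q ls r :
      (p, l, q) \in aut_edges N -> aut_path q ls r ->
      aut_path p (l :: ls) r.

Definition recognised (M : monoidType) (N : automaton M) (m : M) : Prop :=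
  exists (q : 'I_(aut_size N)) (ls : seq M),
    [/\ q \in aut_term N, aut_path (aut_init N) ls q & m = \prod_(l <- ls) l].

Definition word_val (X : Type) (M : monoidType) (gen : X -> M) (w : seq X) : M :=
  \prod_(x <- w) gen x.

Definition map_aut (L L' : eqType) (f : L -> L') (N : automaton L) : automaton L' :=
  {| aut_init := aut_init N;
     aut_term := aut_term N;
     aut_edges := [seq (e.1.1, f e.1.2, e.2) | e <- aut_edges N] |}.

Definition generates (X : Type) (M : monoidType) (gen : X -> M) : Prop :=
  forall m : M, exists w : seq X, m = word_val gen w.

Definition finitely_generated (M : monoidType) : Prop :=
  exists (A : finType) (gen : A -> M), generates gen.

Definition enc_aut (A : finType) (N : automaton (seq A)) : data :=
  DCons (enc_nat (aut_size N))
    (DCons (enc_fin (aut_init N))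
       (DCons (enc_word (enum (aut_term N)))
          (enc_seq (fun e => DCons (enc_fin e.1.1)
                               (DCons (enc_word e.1.2) (enc_fin e.2)))
             (aut_edges N)))).

Definition solves_RSP (M : monoidType) (A : finType) (gen : A -> M) (p : prog) : Prop :=
  forall (N : automaton (seq A)) (m : seq A),
    exists b : bool,
      eval p (DCons (enc_aut N) (enc_word m)) (enc_bool b) /\
      (b <-> recognised (map_aut (word_val gen) N) (word_val gen m)).

(* The existence of a finite generating set is part of the notion; the choice of
   it is irrelevant. *)
Definition decidable_RSP (M : monoidType) : Prop :=
  exists (A : finType) (gen : A -> M),
    generates gen /\ exists p : prog, solves_RSP gen p.

Inductive mcong (X : Type) (R : seq X -> seq X -> Prop) : seq X -> seq X -> Prop :=
  | mcong_rel a u w b : R u w -> mcong R (a ++ u ++ b) (a ++ w ++ b)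
  | mcong_refl u : mcong R u u
  | mcong_sym u w : mcong R u w -> mcong R w u
  | mcong_trans u w z : mcong R u w -> mcong R w z -> mcong R u z.

Record monoid_pres (G : monoidType) (X : choiceType) := MonoidPres {
  mp_gen : X -> G;
  mp_rel : seq X -> seq X -> Prop;
  mp_generates : generates mp_gen;
  mp_correct : forall u w : seq X,
    word_val mp_gen u = word_val mp_gen w <-> mcong mp_rel u w
}.

Section PresentedMonoid.
Variables (X : choiceType) (R : seq X -> seq X -> Prop).

Lemma mcong_ctx a u w b : mcong R u w -> mcong R (a ++ u ++ b) (a ++ w ++ b).
Proof.
elim=> {u w} [c u w d Ruw|u|u w _ IH|u w z _ IH1 _ IH2].
- have e t : a ++ (c ++ t ++ d) ++ b = (a ++ c) ++ t ++ (d ++ b).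
    by rewrite -!catA.
  by rewrite !e; exact: mcong_rel.
- exact: mcong_refl.
- exact: mcong_sym.
- exact: mcong_trans IH1 IH2.
Qed.

Definition mcongb : rel (seq X) := fun u w => `[< mcong R u w >].

Lemma mcongb_refl : reflexive mcongb.
Proof. by move=> u; apply/asboolP/mcong_refl. Qed.
Lemma mcongb_sym : symmetric mcongb.
Proof. by move=> u w; apply/asboolP/asboolP; exact: mcong_sym. Qed.
Lemma mcongb_trans : transitive mcongb.
Proof. by move=> w u z /asboolP uw /asboolP wz; apply/asboolP/(mcong_trans uw wz). Qed.

Canonical mcong_equiv := EquivRel mcongb mcongb_refl mcongb_sym mcongb_trans.

Definition pres_monoid : Type := {eq_quot mcong_equiv}.
HB.instance Definition _ := Choice.on pres_monoid.

Definition pm_class (w : seq X) : pres_monoid := \pi_({eq_quot mcong_equiv}) w.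

Lemma pm_classP u w : pm_class u = pm_class w <-> mcong R u w.
Proof.
split=> [e|h]; first by apply/asboolP; rewrite -[`[< _ >]]/(mcong_equiv u w); apply/eqmodP.
by apply/eqmodP/asboolP.
Qed.

Definition pm_mul (x y : pres_monoid) : pres_monoid :=
  pm_class (generic_quotient.repr (x : {eq_quot mcong_equiv}) ++ generic_quotient.repr (y : {eq_quot mcong_equiv})).

Lemma pm_class_surj (x : pres_monoid) : exists w, x = pm_class w.
Proof. by exists (generic_quotient.repr (x : {eq_quot mcong_equiv})); rewrite /pm_class reprK. Qed.

Lemma pm_class_cat u w : pm_mul (pm_class u) (pm_class w) = pm_class (u ++ w).
Proof.
have h z : mcong R (generic_quotient.repr (pm_class z : {eq_quot mcong_equiv})) z.
  by apply/pm_classP; rewrite [LHS]/pm_class reprK.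
apply/pm_classP; apply: (@mcong_trans _ _ _ (u ++ generic_quotient.repr (pm_class w : {eq_quot mcong_equiv}))).
  exact: (@mcong_ctx [::] _ _ _ (h u)).
by have := @mcong_ctx u _ _ [::] (h w); rewrite !cats0.
Qed.

Lemma pm_mulA : associative pm_mul.
Proof.
move=> x y z; have [u ->] := pm_class_surj x; have [v ->] := pm_class_surj y.
by have [w ->] := pm_class_surj z; rewrite !pm_class_cat catA.
Qed.
Lemma pm_mul1 : left_id (pm_class [::]) pm_mul.
Proof. by move=> x; have [u ->] := pm_class_surj x; rewrite pm_class_cat. Qed.
Lemma pm_mulr1 : right_id (pm_class [::]) pm_mul.
Proof. by move=> x; have [u ->] := pm_class_surj x; rewrite pm_class_cat cats0. Qed.

HB.instance Definition _ := isMonoid.Build pres_monoid pm_mulA pm_mul1 pm_mulr1.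

End PresentedMonoid.

Record graph := Graph {
  vert : finType;
  edge : finType;
  src : edge -> vert;
  tgt : edge -> vert;
  bar : edge -> edge;
  barK : forall y, bar (bar y) = y;
  bar_neq : forall y, bar y <> y;
  src_bar : forall y, src y = tgt (bar y)
}.

Fixpoint gpath (Y : graph) (u : vert Y) (ys : seq (edge Y)) (v : vert Y) : bool :=
  if ys is y :: ys' then (src y == u) && gpath (tgt y) ys' v else u == v.

Definition connected (Y : graph) : Prop :=
  forall u v : vert Y, exists ys : seq (edge Y), gpath u ys v.

(* [egrp_bar] is the equality [G_y = G_(bar y)] of groups, not just an
   isomorphism.  The law [alpha_y = omega_(bar y)] is stated in [{v & vgrp v}], which compares
   elements of [vgrp (src y)] and [vgrp (tgt (bar y))]. *)
Record graph_of_groups (Y : graph) := GraphOfGroups {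
  vgrp : vert Y -> groupType;
  egrp : edge Y -> finGroupType;
  egrp_bar : forall y, egrp y = egrp (bar y);
  alpha : forall y, {multiplicative egrp y -> vgrp (src y)};
  omega : forall y, {multiplicative egrp y -> vgrp (tgt y)};
  alpha_inj : forall y, injective (alpha y);
  omega_inj : forall y, injective (omega y);
  alpha_omega : forall y (g : egrp y),
    existT vgrp (src y) (alpha y g) =
    existT vgrp (tgt (bar y))
      (omega (bar y) (ecast H (H : finGroupType) (egrp_bar y) g))
}.

(* The generators [B] of [F(G,Y)]: edges and vertex generators.  The sum makes
   the union disjoint. *)
Definition letter (Y : graph) (X : vert Y -> choiceType) : choiceType :=
  (edge Y + {v : vert Y & X v})%type.

Section FundamentalGroup.
Variables (Y : graph) (G : graph_of_groups Y) (X : vert Y -> choiceType).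
Variable P : forall v : vert Y, monoid_pres (vgrp G v) (X v).

Definition eletter (y : edge Y) : letter X := inl y.
Definition vletter (v : vert Y) (x : X v) : letter X := inr (existT (fun v => X v) v x).

(* In a relation [y (g omega_y) (bar y) = g alpha_y], the elements of the vertex
   groups are represented by arbitrary words over their generators. *)
Inductive FGY_rel : seq (letter X) -> seq (letter X) -> Prop :=
  | FGY_vertex v u w :
      mp_rel (P v) u w -> FGY_rel (map (@vletter v) u) (map (@vletter v) w)
  | FGY_inverse y : FGY_rel [:: eletter y; eletter (bar y)] [::]
  | FGY_edge y (g : egrp G y) (a : seq (X (src y))) (o : seq (X (tgt y))) :
      word_val (mp_gen (P (src y))) a = alpha G y g ->
      word_val (mp_gen (P (tgt y))) o = omega G y g ->
      FGY_rel (eletter y :: map (@vletter (tgt y)) o ++ [:: eletter (bar y)])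
              (map (@vletter (src y)) a).

Definition FGY : monoidType := pres_monoid FGY_rel.
Definition FGY_class (w : seq (letter X)) : FGY := pm_class FGY_rel w.

(* [w0 y1 w1 ... yn wn] is given by [w0] and the list of the [(yi, wi)]. *)
Definition cycle_word (v0 : vert Y) (w0 : seq (X v0))
    (s : seq {y : edge Y & seq (X (tgt y))}) : seq (letter X) :=
  map (@vletter v0) w0 ++
  flatten [seq eletter (tag t) :: map (@vletter (tgt (tag t))) (tagged t) | t <- s].

Definition cycle_type (v0 : vert Y) (w : seq (letter X)) : Prop :=
  exists (w0 : seq (X v0)) (s : seq {y : edge Y & seq (X (tgt y))}),
    gpath v0 [seq tag t | t <- s] v0 /\ w = cycle_word w0 s.

Definition in_pi1 (v0 : vert Y) : pred FGY :=
  fun f => `[< exists2 w, cycle_type v0 w & f = FGY_class w >].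

End FundamentalGroup.

Arguments FGY_class {Y G X} P w.
Arguments in_pi1 {Y G X} P v0 f.

Section Pi1Monoid.
Variables (Y : graph) (G : graph_of_groups Y) (X : vert Y -> choiceType).
Variable P : forall v : vert Y, monoid_pres (vgrp G v) (X v).
Variable v0 : vert Y.

Lemma gpath_cat (u v w : vert Y) s t :
  gpath u s v -> gpath v t w -> gpath u (s ++ t) w.
Proof. by elim: s u => [|y s IH] u /=; [move/eqP->|move=> /andP[-> /IH]]. Qed.

Lemma cycle_type_cat u w :
  cycle_type (X := X) v0 u -> cycle_type v0 w -> cycle_type v0 (u ++ w).
Proof.
case=> [u0 [s [ps ->]]] [w0 [t [pt ->]]].
case/lastP: s ps => [|s [y z]] ps.
  by exists (u0 ++ w0), t; split=> //; rewrite /cycle_word /= cats0 map_cat -catA.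
have e : tgt y = v0.
  move: ps; rewrite map_rcons /= -cats1.
  move: {1}v0; elim: s => [|x s IH] v /=; first by case/andP=> _ /eqP.
  by case/andP=> _; exact: IH.
case: v0 / e ps w0 t pt u0 => ps w0 t pt u0.
exists u0, (rcons s (existT (fun y => seq (X (tgt y))) y (z ++ w0)) ++ t); split.
  rewrite map_cat; apply: gpath_cat pt.
  by move: ps; rewrite !map_rcons.
rewrite /cycle_word map_cat flatten_cat !map_rcons !flatten_rcons /=.
by rewrite map_cat -!catA /= -!catA.
Qed.

Lemma in_pi1_closed : monoid_closed (in_pi1 P v0).
Proof.
split=> [|x y /asboolP[u cu ->] /asboolP[w cw ->]].
  apply/asboolP; exists [::] => //.
  by exists [::], [::]; split=> /=.
apply/asboolP; exists (u ++ w); first exact: cycle_type_cat.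
exact: pm_class_cat.
Qed.

(* Only the monoid structure of the fundamental group matters for the rational
   subset problem, so that is what is equipped here. *)
Definition pi1 : Type := {f : FGY P | in_pi1 P v0 f}.
HB.instance Definition _ := SubChoice.on pi1.
HB.instance Definition _ :=
  SubChoice_isSubMonoid.Build (FGY P) (in_pi1 P v0) pi1 in_pi1_closed.

End Pi1Monoid.

(* A finite description of a graph of groups whose vertex groups have finite
   generating sets [A v], together with a finite generating set [S] of the
   fundamental group at a base vertex.  Words stand for group elements, and no
   information on the relations holding in the groups is included. *)
Record gog_data (Y : graph) (G : graph_of_groups Y) (A : vert Y -> finType)
    (S : finType) := GogData {
  d_alpha : forall y, egrp G y -> seq (A (src y));
  d_omega : forall y, egrp G y -> seq (A (tgt y));
  d_gen : S -> seq (letter A);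
  d_path : vert Y -> seq (edge Y);
  d_conj : forall v, A v -> seq S
}.

(* The words [d_gen] express the generators of the fundamental group in [B].
   Conversely, for the chosen path [y1 ... yn] from the base vertex to [v],
   [d_conj x] is a word over [S] for [y1 ... yn x (bar yn) ... (bar y1)].
   Without such a dictionary, an algorithm that only answers questions about [S]
   could not be related to the generators of the vertex groups. *)
Record describes (Y : graph) (G : graph_of_groups Y) (A : vert Y -> finType)
    (P : forall v, monoid_pres (vgrp G v) (A v)) (v0 : vert Y)
    (S : finType) (gen : S -> pi1 P v0) (D : gog_data G A S) : Prop := Describes {
  d_alphaP : forall y g, word_val (mp_gen (P (src y))) (d_alpha D g) = alpha G y g;
  d_omegaP : forall y g, word_val (mp_gen (P (tgt y))) (d_omega D g) = omega G y g;
  d_gen_cycle : forall s, cycle_type v0 (d_gen D s);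
  d_genP : forall s, val (gen s) = FGY_class P (d_gen D s);
  d_pathP : forall v, gpath v0 (d_path D v) v;
  d_conjP : forall v (x : A v),
    val (word_val gen (d_conj D x)) =
    FGY_class P (map (@eletter Y _) (d_path D v) ++ vletter x ::
                 map (@eletter Y _) (rev (map (@bar Y) (d_path D v))))
}.

Definition enc_letter (Y : graph) (A : vert Y -> finType) (l : letter A) : data :=
  match l with
  | inl y => DCons DNil (enc_fin y)
  | inr (existT v x) => DCons (DCons DNil DNil) (DCons (enc_fin v) (enc_fin x))
  end.

Definition enc_list : seq data -> data := enc_seq id.

Definition enc_graph (Y : graph) : data :=
  DCons (enc_nat #|vert Y|)
    (enc_seq (fun y => enc_list [:: enc_fin (src y); enc_fin (tgt y); enc_fin (bar y)])
       (enum (edge Y))).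

Definition enc_gog (Y : graph) (G : graph_of_groups Y) (A : vert Y -> finType)
    (v0 : vert Y) (S : finType) (D : gog_data G A S) : data :=
  enc_list [::
    enc_graph Y;
    enc_fin v0;
    enc_seq (fun v => enc_nat #|A v|) (enum (vert Y));
    enc_nat #|S|;
    enc_seq (fun y => enc_seq (fun g : egrp G y =>
               DCons (enc_word (d_alpha D g)) (enc_word (d_omega D g)))
             (enum (egrp G y)))
      (enum (edge Y));
    enc_seq (fun s => enc_seq (@enc_letter Y A) (d_gen D s)) (enum S);
    enc_seq (fun v => enc_word (d_path D v)) (enum (vert Y));
    enc_seq (fun v => enc_seq (fun x => enc_word (d_conj D x)) (enum (A v)))
      (enum (vert Y))].

Definition enc_progs (T : finType) (p : T -> prog) : data :=
  enc_seq (fun x => code (p x)) (enum T).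

(* Main.v *)
From HB Require Import structures.
Require Import Defs.
From mathcomp Require Import all_boot all_fingroup.
From mathcomp Require Import boolp.
Set Implicit Arguments.
Unset Strict Implicit.
Unset Printing Implicit Defensive.

Local Open Scope group_scope.

(* By Britton's lemma, a word of cycle type with value [1] that contains edge
   letters has a factor [y w (bar y)] with [w] a word over the generators of the
   vertex group at the end of [y] whose value is [omega_y g] for some [g].  So if
   an automaton over the letters is saturated with an edge labelled [alpha_y g]
   alongside every such factor, it accepts [1] if and only if it does so by a
   path reading only generators of the base vertex group.  Both the saturation
   and this last question only need the rational subset problem of the vertex
   groups.  Membership of [m] is reduced to membership of [1] by appending a word
   for the inverse of [m], which is found by exhaustive search.

   Conversely each vertex group embeds in the fundamental group by conjugation
   along a path, so its automata can be translated letter by letter. *)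

(** * Normal forms in HNN extensions *)

(** Saturation terminates because the candidate edges are fixed in advance. A new edge is labelled
    by a word over vertex generators, so the two edge letters of a factor [y w (bar y)] are always
    read along edges of the original automaton; that automaton and the groups [G_y] are finite, so
    there are finitely many choices of two such edges and an element [g], and each choice yields one
    edge. Such a factor can be cut out of a path only if its edge letters are labels of their own,
    which is why the automaton is first expanded to read letter by letter. Britton's lemma comes
    from an action of [F(G,Y)] on the normal forms of an HNN extension: a word without a reducible
    factor never causes a cancellation there. Effectivity concerns codes of programs: each new
    solver contains the given ones as subprograms, so its code is assembled from theirs by syntax
    alone, without an interpreter. *)

Section Prod.
Variables (I : finType) (G : I -> groupType).

Definition gprod : Type := {dffun forall i, G i}.
HB.instance Definition _ := Choice.on gprod.

Let mul (f g : gprod) : gprod := [ffun i => f i * g i].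
Let one : gprod := [ffun i => 1].
Let inv (f : gprod) : gprod := [ffun i => (f i)^-1].

Let mulA : associative mul.
Proof. by move=> f g h; apply/ffunP => i; rewrite !ffunE mulgA. Qed.
Let mul1 : left_id one mul.
Proof. by move=> f; apply/ffunP => i; rewrite !ffunE mul1g. Qed.
Let mulr1 : right_id one mul.
Proof. by move=> f; apply/ffunP => i; rewrite !ffunE mulg1. Qed.
Let mulV : left_inverse one inv mul.
Proof. by move=> f; apply/ffunP => i; rewrite !ffunE mulVg. Qed.
Let mulrV : right_inverse one inv mul.
Proof. by move=> f; apply/ffunP => i; rewrite !ffunE mulgV. Qed.
HB.instance Definition _ := isGroup.Build gprod mulA mul1 mulr1 mulV mulrV.

Definition gproj (i : I) (f : gprod) : G i := f i.

Lemma gproj1 i : gproj i 1 = 1.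
Proof. by rewrite /gproj ffunE. Qed.

Definition ginj (i : I) (x : G i) : gprod :=
  [ffun j => if pselect (i = j) is left e then ecast k (G k) e x else 1].

Lemma ginjK i (x : G i) : gproj i (ginj x) = x.
Proof.
rewrite /gproj ffunE; case: pselect => [e|//].
by rewrite (Prop_irrelevance e (erefl i)).
Qed.

Lemma ginjM i (x y : G i) : ginj (x * y) = ginj x * ginj y.
Proof.
apply/ffunP => j; rewrite !ffunE; case: pselect => [e|_]; last by rewrite mulg1.
by case: j / e.
Qed.

Lemma ginj1 i : ginj (1 : G i) = 1.
Proof.
apply/ffunP => j; rewrite !ffunE; case: pselect => [e|//].
by case: j / e.
Qed.

End Prod.

Section HNN.
Variables (Gm : groupType) (E : eqType) (bar : E -> E).
(** [assoc y a b] stands for the relation [y b (bar y) = a]. Encoding the two associated subgroups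
    and their isomorphism as one relation turns the passage to [bar y] into a swap of arguments. *)
Variable assoc : E -> Gm -> Gm -> Prop.
Hypothesis barK : involutive bar.
Hypothesis assocM : forall y a b a' b',
  assoc y a b -> assoc y a' b' -> assoc y (a * a') (b * b').
Hypothesis assocV : forall y a b, assoc y a b -> assoc y a^-1 b^-1.
Hypothesis assoc1 : forall y, assoc y 1 1.
Hypothesis assoc_bar : forall y a b, assoc y a b -> assoc (bar y) b a.
Hypothesis assoc_fun : forall y a a' b, assoc y a b -> assoc y a' b -> a = a'.

Definition in_cod y b := exists a, assoc y a b.

Let cod1 y : in_cod y 1. Proof. by exists 1. Qed.
Let codM y a b : in_cod y a -> in_cod y b -> in_cod y (a * b).
Proof. by case=> a' ra [b' rb]; exists (a' * b'); exact: assocM. Qed.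
Let codV y a : in_cod y a -> in_cod y a^-1.
Proof. by case=> a' ra; exists a'^-1; exact: assocV. Qed.
Let cod_l y a b : in_cod y a -> in_cod y (a * b) -> in_cod y b.
Proof. by move=> ha hab; rewrite -(mulKg a b); apply: codM => //; exact: codV. Qed.
Lemma in_cod_r y a b : in_cod y b -> in_cod y (a * b) -> in_cod y a.
Proof. by move=> hb hab; rewrite -(mulgK b a); apply: codM => //; exact: codV. Qed.

(** Representatives of right cosets of the subgroup [in_cod y]. The value [1] is forced on the
    subgroup itself, so that [coset_rep y g = 1] tests membership. *)
Definition coset_rep y (g : Gm) : Gm :=
  if `[< in_cod y g >] then 1 else choose (fun x => `[< in_cod y (g * x^-1) >]) g.

Lemma coset_repP y g : in_cod y (g * (coset_rep y g)^-1).
Proof.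
rewrite /coset_rep; case: asboolP => [h|_]; first by rewrite invg1 mulg1.
apply/asboolP; apply: (@chooseP _ (fun x => `[< in_cod y (g * x^-1) >])).
by apply/asboolP; rewrite mulgV; exact: cod1.
Qed.

Lemma coset_rep1 y g : in_cod y g -> coset_rep y g = 1.
Proof. by rewrite /coset_rep => /asboolP ->. Qed.

Lemma coset_rep_eq1 y g : coset_rep y g = 1 -> in_cod y g.
Proof. by move=> e; have := coset_repP y g; rewrite e invg1 mulg1. Qed.

(** Both sides choose from the same coset, and [choose_id] removes the dependence on the starting
    point of the choice. *)
Lemma coset_repM y b g : in_cod y b -> coset_rep y (b * g) = coset_rep y g.
Proof.
move=> hb; rewrite /coset_rep.
have e z : `[< in_cod y (b * z) >] = `[< in_cod y z >].
  by apply/asboolP/asboolP => [|h]; [exact: cod_l | exact: codM].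
rewrite e; case: ifP => // _.
have e2 : (fun x => `[< in_cod y (b * g * x^-1) >]) =1
          (fun x => `[< in_cod y (g * x^-1) >]).
  by move=> x /=; rewrite -mulgA e.
rewrite (eq_choose e2); apply: choose_id; apply/asboolP; last by rewrite mulgV; exact: cod1.
by rewrite invgM mulVKg; exact: codV.
Qed.

Lemma coset_rep_id y g : coset_rep y (coset_rep y g) = coset_rep y g.
Proof.
by rewrite -[RHS](coset_repM _ (codV (coset_repP y g))) invgM invgK mulgVK.
Qed.

(** The subgroup part of [g], carried across the stable letter:
    [y g = cod_lift y g * y * coset_rep y g] in the HNN extension. *)
Definition cod_lift y g : Gm :=
  if pselect (exists a, assoc y a (g * (coset_rep y g)^-1)) is left h
  then projT1 (cid h) else 1.

Lemma cod_liftP y g : assoc y (cod_lift y g) (g * (coset_rep y g)^-1).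
Proof.
rewrite /cod_lift; case: pselect => [h|[]]; first exact: projT2 (cid h).
exact: coset_repP.
Qed.

Lemma cod_liftM y a b g : assoc y a b -> cod_lift y (b * g) = a * cod_lift y g.
Proof.
move=> h; apply: (assoc_fun (cod_liftP y (b * g))).
rewrite coset_repM -?mulgA; last by exists a.
exact: assocM h (cod_liftP y g).
Qed.

Fixpoint normal (l : seq (E * Gm)) : bool :=
  if l is (y, c) :: l' then
    [&& coset_rep y c == c,
        (if l' is (y', _) :: _ then ~~ ((c == 1) && (y' == bar y)) else true)
      & normal l']
  else true.

(* Left multiplication by the stable letter [y] on normal forms
   [g y1 c1 ... yn cn], where [ci] is a coset representative. *)
Definition push y (s : Gm * seq (E * Gm)) : Gm * seq (E * Gm) :=
  let keep := (cod_lift y s.1, (y, coset_rep y s.1) :: s.2) in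
  if s.2 is (y', c) :: l then
    if (coset_rep y s.1 == 1) && (y' == bar y) then (cod_lift y s.1 * c, l) else keep
  else keep.

Lemma push_normal y s : normal s.2 -> normal (push y s).2.
Proof.
rewrite /push; case: s => g [|[y' c] l] /=; first by rewrite coset_rep_id eqxx.
move=> nl; case: ifP => [_|h] /=; first by case/and3P: nl.
by rewrite coset_rep_id eqxx h.
Qed.

Lemma pushM y a b g l :
  assoc y a b -> push y (b * g, l) = (a * (push y (g, l)).1, (push y (g, l)).2).
Proof.
move=> h; rewrite /push /= (cod_liftM _ h) coset_repM; last by exists a.
by case: l => [|[y' c] l] //; case: ifP => _ //=; rewrite mulgA.
Qed.

(** A lift along [y] lies in the subgroup of [bar y], so its representative there is [1]. If
    [push y] kept its letter, this makes [bar y] cancel it; if [push y] cancelled [(bar y, c)], the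
    same fact recovers [c] as the representative of the product. *)
Lemma pushK y s : normal s.2 -> push (bar y) (push y s) = s.
Proof.
have back g : coset_rep (bar y) (cod_lift y g) = 1 /\
    cod_lift (bar y) (cod_lift y g) = g * (coset_rep y g)^-1.
  have h := assoc_bar (cod_liftP y g).
  have e : coset_rep (bar y) (cod_lift y g) = 1 by apply: coset_rep1; eexists; exact: h.
  split=> //; apply: (assoc_fun (cod_liftP _ _)).
  by rewrite e invg1 mulg1.
case: s => g l; have [b1 b2] := back g.
have keep : push (bar y) (cod_lift y g, (y, coset_rep y g) :: l) = (g, l).
  by rewrite /push /= b1 barK !eqxx b2 mulgVK.
case: l keep => [|[y' c] l] //= keep; rewrite {2}/push /=.
case: ifP => // /andP[/eqP r1 /eqP ->] /and3P[/eqP rc nc nl].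
have h : assoc (bar y) g (cod_lift y g).
  by have := assoc_bar (cod_liftP y g); rewrite r1 invg1 mulg1.
rewrite /push /= coset_repM; last by exists g.
rewrite rc (cod_liftM _ h).
have -> : cod_lift (bar y) c = 1.
  by apply: (assoc_fun (cod_liftP _ _)); rewrite rc mulgV; exact: assoc1.
rewrite mulg1.
(* Normality of the original form prevents the restored letter [bar y] from cancelling with the next
   one. *)
by case: l nc {nl keep} => [|[y'' c'] l] // /negbTE ->.
Qed.

End HNN.

Lemma word_val_cat (X : Type) (M : monoidType) (gen : X -> M) u w :
  word_val gen (u ++ w) = word_val gen u * word_val gen w.
Proof. by rewrite /word_val big_cat. Qed.

Lemma word_val_cons (X : Type) (M : monoidType) (gen : X -> M) x w :
  word_val gen (x :: w) = gen x * word_val gen w.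
Proof. by rewrite /word_val big_cons. Qed.

Lemma word_val_nil (X : Type) (M : monoidType) (gen : X -> M) :
  word_val gen [::] = 1.
Proof. by rewrite /word_val big_nil. Qed.

Lemma word_val1 (X : Type) (M : monoidType) (gen : X -> M) x :
  word_val gen [:: x] = gen x.
Proof. by rewrite word_val_cons word_val_nil mulg1. Qed.

Lemma word_val_map (X Z : Type) (M : monoidType) (gen : X -> M) (f : Z -> X) w :
  word_val gen (map f w) = word_val (gen \o f) w.
Proof. by rewrite /word_val big_map. Qed.

Lemma multiplicative1 (G H : groupType) (f : {multiplicative G -> H}) : f 1 = 1.
Proof. by apply: (mulgI (f 1)); rewrite -gmulfM !mulg1. Qed.

Lemma multiplicativeV (G H : groupType) (f : {multiplicative G -> H}) x :
  f x^-1 = (f x)^-1.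
Proof. by apply: (mulgI (f x)); rewrite -gmulfM !mulgV multiplicative1. Qed.

(** * The group F(G,Y) and Britton's lemma *)

Section VertexGroups.
Variables (Y : graph) (G : graph_of_groups Y) (X : vert Y -> choiceType).
Variable P : forall v : vert Y, monoid_pres (vgrp G v) (X v).

Lemma FGY_class_cat u w : FGY_class P (u ++ w) = FGY_class P u * FGY_class P w.
Proof. by rewrite [RHS]pm_class_cat. Qed.

Lemma mcong_vertex v u w :
  mcong (mp_rel (P v)) u w ->
  mcong (FGY_rel P) (map (@vletter Y X v) u) (map (@vletter Y X v) w).
Proof.
elim=> {u w} [c u w d h|u|u w _ IH|u w z _ IH1 _ IH2].
- by rewrite !map_cat; apply: mcong_rel; exact: FGY_vertex.
- exact: mcong_refl.
- exact: mcong_sym.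
- exact: mcong_trans IH1 IH2.
Qed.

Definition vincl v (g : vgrp G v) : FGY P :=
  FGY_class P (map (@vletter Y X v) (projT1 (cid (mp_generates (P v) g)))).

Definition stable (y : edge Y) : FGY P := FGY_class P [:: eletter X y].

Lemma FGY_class_vertex v w :
  FGY_class P (map (@vletter Y X v) w) = vincl (word_val (mp_gen (P v)) w).
Proof.
apply/pm_classP/mcong_vertex/mp_correct.
exact: projT2 (cid (mp_generates (P v) _)).
Qed.

Lemma vinclM v (g h : vgrp G v) : vincl (g * h) = vincl g * vincl h.
Proof.
have [u ->] := mp_generates (P v) g; have [w ->] := mp_generates (P v) h.
by rewrite -word_val_cat -!FGY_class_vertex map_cat FGY_class_cat.
Qed.

Lemma vincl1 v : vincl (1 : vgrp G v) = 1.
Proof. by rewrite -(word_val_nil (mp_gen (P v))) -FGY_class_vertex. Qed.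

Lemma stableK y : stable y * stable (bar y) = 1.
Proof.
rewrite -FGY_class_cat /=; apply/pm_classP.
exact: (mcong_rel [::] [::] (FGY_inverse P y)).
Qed.

Lemma stable_conj y (g : egrp G y) :
  stable y * vincl (omega G y g) * stable (bar y) = vincl (alpha G y g).
Proof.
have [o eo] := mp_generates (P (tgt y)) (omega G y g).
have [a ea] := mp_generates (P (src y)) (alpha G y g).
rewrite eo ea -!FGY_class_vertex /stable -(FGY_class_cat [:: _]) -(FGY_class_cat (_ :: _)).
apply/pm_classP; have := mcong_rel [::] [::] (FGY_edge (esym ea) (esym eo)).
by rewrite /= !cats0.
Qed.

(* The product of all vertex groups serves as the base of an HNN extension with
   stable letters the edges; this embeds [F(G,Y)] without any vertex typing. *)
Let Gam := gprod (vgrp G).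

Definition eassoc (y : edge Y) (a b : Gam) : Prop :=
  exists g : egrp G y, a = ginj (alpha G y g) /\ b = ginj (omega G y g).

Lemma eassocM y a b a' b' :
  eassoc y a b -> eassoc y a' b' -> eassoc y (a * a') (b * b').
Proof.
by case=> g [-> ->] [h [-> ->]]; exists (g * h); rewrite !gmulfM -!ginjM.
Qed.

Lemma eassoc1 y : eassoc y 1 1.
Proof. by exists 1; rewrite !multiplicative1 !ginj1. Qed.

Lemma eassoc_fun y a a' b : eassoc y a b -> eassoc y a' b -> a = a'.
Proof.
case=> g [-> eg] [h [-> eh]]; congr (ginj (alpha G y _)).
by apply: (@omega_inj _ G y); rewrite -(ginjK (omega _ y g)) -eg eh ginjK.
Qed.

Let gin (x : {v : vert Y & vgrp G v}) : Gam := ginj (tagged x).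

(** The law [alpha_y = omega_(bar y)] is used for [y] and for [bar y]. The second use lands in
    [bar (bar y)], and the two accumulated casts collapse by proof irrelevance. *)
Lemma eassoc_bar y a b : eassoc y a b -> eassoc (bar y) b a.
Proof.
have om_cast y' (e : y' = y) (H : egrp G y = egrp G y') (g : egrp G y) :
    ginj (omega G y' (ecast K (K : finGroupType) H g)) = ginj (omega G y g) :> Gam.
  by case: y / e H g => H g; rewrite (Prop_irrelevance H (erefl _)).
case=> g [-> ->]; exists (ecast H (H : finGroupType) (egrp_bar G y) g); split; last first.
  exact: (congr1 gin (alpha_omega g)).
have := congr1 gin (alpha_omega (ecast H (H : finGroupType) (egrp_bar G y) g)).
rewrite /gin /= => ->; symmetry.
have e t (H1 : egrp G y = egrp G (bar y)) (H2 : egrp G (bar y) = egrp G t) :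
   ecast H (H : finGroupType) H2 (ecast H (H : finGroupType) H1 g) =
   ecast H (H : finGroupType) (etrans H1 H2) g.
  by case: _ / H2.
by rewrite e; apply: om_cast; exact: barK.
Qed.

Lemma eassocV y a b : eassoc y a b -> eassoc y a^-1 b^-1.
Proof.
have ginjV v (x : vgrp G v) : (ginj x : Gam)^-1 = ginj x^-1.
  by apply: (mulgI (ginj x)); rewrite -ginjM !mulgV ginj1.
by case=> g [-> ->]; exists g^-1; rewrite !multiplicativeV -!ginjV.
Qed.

Let cod := in_cod eassoc.
Let rep := coset_rep eassoc.
Let nf := normal (@bar Y) eassoc.
Let pushY := push (@bar Y) eassoc.

Definition act_letter (l : letter X) (s : Gam * seq (edge Y * Gam)) :=
  match l with
  | inl y => pushY y s
  | inr (existT v x) => (ginj (mp_gen (P v) x) * s.1, s.2)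
  end.

Definition act_word (w : seq (letter X)) s := foldr act_letter s w.

Lemma act_word_cat u w s : act_word (u ++ w) s = act_word u (act_word w s).
Proof. exact: foldr_cat. Qed.

Lemma act_word_vertex v (w : seq (X v)) s :
  act_word (map (@vletter Y X v) w) s =
  (ginj (word_val (mp_gen (P v)) w) * s.1, s.2).
Proof.
elim: w => [|x w IH] /=; first by rewrite word_val_nil ginj1 mul1g; case: s.
by rewrite IH word_val_cons ginjM mulgA.
Qed.

Lemma act_word_normal w s : nf s.2 -> nf (act_word w s).2.
Proof.
move=> h; elim: w => [|[y|[v x]] w IH] //=; apply: push_normal => //;
  [exact: eassocM | exact: eassocV | exact: eassoc1].
Qed.

(** The relation [y (bar y) = 1] acts trivially by [pushK], which needs a normal form; the edge
    relation reduces to it by [pushM]. *)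
Lemma act_word_mcong u w s :
  mcong (FGY_rel P) u w -> nf s.2 -> act_word u s = act_word w s.
Proof.
have pK y t : nf t.2 -> pushY y (pushY (bar y) t) = t.
  move=> nt; rewrite -{1}(barK y); apply: pushK nt;
    [exact: barK | exact: eassocM | exact: eassocV | exact: eassoc1
    | exact: eassoc_bar | exact: eassoc_fun].
have push_cod y (g : egrp G y) t :
    pushY y (ginj (omega G y g) * t.1, t.2) =
    (ginj (alpha G y g) * (pushY y t).1, (pushY y t).2).
  case: t => t1 t2 /=; apply: pushM;
    [exact: eassocM|exact: eassocV|exact: eassoc1|exact: eassoc_fun|].
  by exists g.
move=> h; elim: h s => {u w} [c u w d h|u|u w _ IH|u w z _ IH1 _ IH2] s ns //.
- rewrite !act_word_cat; congr act_word.
  have := act_word_normal d ns; move: (act_word d s) => {ns d}s ns.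
  case: h => [v {}u {}w h|y|y g a o ea eo].
  + have e : word_val (mp_gen (P v)) u = word_val (mp_gen (P v)) w.
      by have := mcong_rel [::] [::] h; rewrite /= !cats0 => /mp_correct.
    by rewrite !act_word_vertex e.
  + exact: pK.
  + rewrite /= act_word_cat !act_word_vertex ea eo /=.
    by rewrite push_cod pK.
- by rewrite IH.
- by rewrite IH1 // IH2.
Qed.

Definition act (f : FGY P) s := act_word (projT1 (cid (pm_class_surj f))) s.

Lemma act_class w s : nf s.2 -> act (FGY_class P w) s = act_word w s.
Proof.
move=> ns; apply: act_word_mcong ns; apply/pm_classP; symmetry.
exact: projT2 (cid (pm_class_surj _)).
Qed.

Lemma act_normal f s : nf s.2 -> nf (act f s).2.
Proof. exact: act_word_normal. Qed.

Lemma actM f h s : nf s.2 -> act (f * h) s = act f (act h s).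
Proof.
move=> ns; have [u ->] := pm_class_surj f; have [w ->] := pm_class_surj h.
rewrite -FGY_class_cat (act_class _ ns) (act_class w ns) act_word_cat act_class //.
exact: act_word_normal.
Qed.

Lemma act_vincl v (g : vgrp G v) s : nf s.2 -> act (vincl g) s = (ginj g * s.1, s.2).
Proof.
move=> ns; have [w ->] := mp_generates (P v) g.
by rewrite -FGY_class_vertex act_class // act_word_vertex.
Qed.

Lemma act_stable y s : nf s.2 -> act (stable y) s = pushY y s.
Proof. by move=> ns; rewrite act_class. Qed.

Lemma act1 s : nf s.2 -> act 1 s = s.
Proof. by move=> ns; rewrite -[1]/(FGY_class P [::]) act_class. Qed.

(** Acting on the trivial normal form leaves [g] visible in the coordinate [v] of the product. *)
Lemma vincl_inj v : injective (@vincl v).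
Proof.
move=> g h /(congr1 (fun f => act f (1, [::]))).
by rewrite !act_vincl //= !mulg1 => -[/(congr1 (@gproj _ _ v))]; rewrite !ginjK.
Qed.

Section Words.
Variables (A : vert Y -> choiceType) (a : forall v, A v -> vgrp G v).

(** The alphabet [A] of the automata is kept apart from the alphabet [X] of the presentations, which
    may be infinite. *)
Definition letter_val (l : letter A) : FGY P :=
  match l with inl y => stable y | inr (existT v x) => vincl (a x) end.

Lemma letter_val_vertex v (w : seq (A v)) :
  word_val letter_val (map (@vletter Y A v) w) = vincl (word_val (@a v) w).
Proof.
elim: w => [|x w IH]; first by rewrite !word_val_nil vincl1.
by rewrite /= !word_val_cons IH vinclM.
Qed.

(** Between equal ends these are the words of cycle type; allowing different ends makes the notion
    stable under cutting and induction on letters. *)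
Fixpoint typed_word (u : vert Y) (w : seq (letter A)) (v : vert Y) : bool :=
  match w with
  | [::] => u == v
  | inl y :: w' => (src y == u) && typed_word (tgt y) w' v
  | inr (existT x _) :: w' => (x == u) && typed_word u w' v
  end.

Lemma typed_word_cat u w1 w2 v :
  reflect (exists2 x, typed_word u w1 x & typed_word x w2 v) (typed_word u (w1 ++ w2) v).
Proof.
elim: w1 u => [|[y|[z c]] w1 IH] u /=.
- apply: (iffP idP) => [h|[x /eqP->]] //; by exists u.
- case: eqP => _ /=; last by right; case.
  exact: IH.
- case: eqP => _ /=; last by right; case.
  exact: IH.
Qed.

Lemma typed_word_vertex v (w : seq (A v)) u x :
  typed_word u (map (@vletter Y A v) w) x = (u == x) && ((w == [::]) || (v == u)).
Proof.
elim: w => [|c w IH] /=; first by rewrite andbT.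
by rewrite IH; case: (v == u); rewrite ?orbT ?andbF ?andbT.
Qed.

Lemma cycle_type_typed v w : cycle_type v w -> typed_word v w v.
Proof.
case=> w0 [s [ps ->]] {w}; rewrite /cycle_word; apply/typed_word_cat.
exists v; first by rewrite typed_word_vertex !eqxx orbT.
move: ps; move: {1 3}v => u; elim: s u => [|[y w] s IH] u //= /andP[-> h] /=.
apply/typed_word_cat; exists (tgt y); last exact: IH.
by rewrite typed_word_vertex !eqxx orbT.
Qed.

Lemma typed_cycle_type v w : typed_word v w v -> cycle_type v w.
Proof.
suff h u : typed_word u w v ->
    exists w0 s, gpath u [seq tag t | t <- s] v /\ w = cycle_word (v0 := u) w0 s.
  exact: h.
elim: w u => [|[y|[z c]] w IH] u /=.
- by move=> e; exists [::], [::].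
- case/andP=> e /IH[w0 [s [ps ->]]].
  exists [::], (existT (fun y => seq (A (tgt y))) y w0 :: s).
  by rewrite /= e.
- case/andP=> /eqP e; case: u / e => /IH[w0 [s [ps ->]]].
  by exists (c :: w0), s.
Qed.

(** Induction from the right end of the word. As long as the action on the trivial normal form
    cancels nothing, the result starts with the first edge letter of the word; the first
    cancellation exhibits a reducible factor. *)
Lemma britton u w v :
  typed_word u w v -> word_val letter_val w = 1 ->
  (exists w0 : seq (A u), w = map (@vletter Y A u) w0 /\ word_val (@a u) w0 = 1) \/
  (exists w1 y (o : seq (A (tgt y))) (g : egrp G y) w2,
    w = w1 ++ eletter A y :: map (@vletter Y A (tgt y)) o ++ eletter A (bar y) :: w2 /\
    word_val (@a (tgt y)) o = omega G y g).
Proof.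
(* [w0] is the leading block of vertex letters. The remainder [b] of the base coordinate lies in the
   subgroup attached to the first edge letter of [r], so membership of the whole coordinate in that
   subgroup depends on [w0] alone. *)
pose shape u w := exists (w0 : seq (A u)) r b l,
  [/\ w = map (@vletter Y A u) w0 ++ r,
      act (word_val letter_val w) (1, [::]) = (ginj (word_val (@a u) w0) * b, l)
    & match r with
      | [::] => l = [::] /\ b = 1
      | inl y :: _ => (exists c l', l = (y, c) :: l') /\ exists c, eassoc y b c
      | _ => False
      end].
set redex := (X in _ \/ X).
have sh : typed_word u w v -> redex \/ shape u w.
  rewrite {}/redex; elim: w u => [|[y|[z c]] w IH] u /=.
  - right; exists [::], [::], 1, [::]; split=> //.
    by rewrite !word_val_nil act1 // ginj1 mulg1.
  - case/andP=> /eqP su; case: u / su => /IH [[w1 [y' [o [g [w2 [-> eg]]]]]]|].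
      by left; exists (inl y :: w1), y', o, g, w2.
    case=> w0 [r [b [l [ew eact hr]]]].
    have eact' : act (word_val letter_val (inl y :: w)) (1, [::]) =
        pushY y (ginj (word_val (@a (tgt y)) w0) * b, l).
      rewrite word_val_cons actM // act_stable; last exact: act_normal.
      by rewrite eact.
    have keep : (forall x, x = ginj (word_val (@a (tgt y)) w0) * b ->
        pushY y (x, l) = (cod_lift eassoc y x, (y, rep y x) :: l)) ->
        shape (src y) (inl y :: w).
      move=> /(_ _ erefl) e; exists [::], (inl y :: w),
        (cod_lift eassoc y (ginj (word_val (@a (tgt y)) w0) * b)).
      eexists; split=> //; first by rewrite eact' e word_val_nil ginj1 mul1g.
      split; first by do 2!eexists.
      by eexists; exact: (cod_liftP eassoc1 _ _).
    case: l eact hr eact' keep => [|[y' c] l] eact hr eact' keep.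
      by right; apply: keep => x _.
    have [/andP[/eqP r1 /eqP ey]|nc] := boolP
        ((rep y (ginj (word_val (@a (tgt y)) w0) * b) == 1) && (y' == bar y)); last first.
      by right; apply: keep => x ->; rewrite /pushY /push /= (negbTE nc).
    left; case: r ew hr => [|[y''|?] r] ew //; first by case.
    case=> -[c' [l' [e1 _ _]]] [d hd]; subst y' y''.
    (* The first letter of [r] is [bar y], so [b] lies in the subgroup of [y] and can be divided
       off. *)
    have hb : cod y b by exists d; rewrite -(barK y); exact: eassoc_bar.
    have /(in_cod_r eassocM eassocV hb) [x [g [_ eg]]] :
        cod y (ginj (word_val (@a (tgt y)) w0) * b).
      exact: (coset_rep_eq1 eassoc1 r1).
    exists [::], y, w0, g, r; split; first by rewrite ew.
    by rewrite -[LHS](ginjK (G := vgrp G)) eg ginjK.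
  - case/andP=> /eqP su; case: u / su => /IH [[w1 [y' [o [g [w2 [-> eg]]]]]]|].
      by left; exists (inr (existT _ z c) :: w1), y', o, g, w2.
    case=> w0 [r [b [l [ew eact hr]]]]; right.
    exists (c :: w0), r, b, l; split=> //; first by rewrite ew.
    rewrite !word_val_cons actM // act_vincl; last exact: act_normal.
    by rewrite eact ginjM mulgA.
move=> /sh [rx|]; first by right.
case=> w0 [r [b [l [ew eact hr]]]] e1; left; exists w0.
(* A word of value [1] fixes the trivial normal form, which leaves no room for an edge letter in
   [r]. *)
move: eact; rewrite e1 act1 // => -[e2 el]; subst l.
case: r ew hr => [|[y|?] r] // ew; last by case=> -[? [? ]].
case=> _ eb; rewrite cats0 in ew; split=> //.
by move: e2; rewrite eb mulg1 => /(congr1 (@gproj _ _ u)); rewrite ginjK gproj1.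
Qed.

End Words.
End VertexGroups.

(** * Programs and their encodings *)

Section Encodings.

Lemma enc_nat_inj : injective enc_nat.
Proof. by elim=> [|m IH] [|n] //= [/IH ->]. Qed.

Lemma enc_fin_inj (T : finType) : injective (@enc_fin T).
Proof. by move=> x y /enc_nat_inj/val_inj/enum_rank_inj. Qed.

Lemma enc_seq_inj (T : Type) (enc : T -> data) : injective enc -> injective (enc_seq enc).
Proof. by move=> inj; elim=> [|x s IH] [|y t] //= [/inj -> /IH ->]. Qed.

Lemma enc_seq_map (T U : Type) (enc : U -> data) (f : T -> U) s :
  enc_seq enc (map f s) = enc_seq (enc \o f) s.
Proof. by elim: s => //= x s ->. Qed.

Lemma enc_nat_nseq n : enc_nat n = enc_seq (fun _ : unit => DNil) (nseq n tt).
Proof. by elim: n => //= n ->. Qed.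

Lemma enc_fin_ord n (i : 'I_n) : enc_fin i = enc_nat i.
Proof. by rewrite /enc_fin enum_rank_ord. Qed.

(** Elements are encoded by rank, so a program can list a finite type knowing only its
    cardinality. *)
Lemma enc_enum (T : finType) :
  enc_seq (@enc_fin T) (enum T) = enc_seq enc_nat (iota 0 #|T|).
Proof.
rewrite /enc_fin -[RHS](_ : enc_seq enc_nat [seq (enum_rank x : nat) | x <- enum T] = _).
  by rewrite enc_seq_map.
congr enc_seq; apply: (@eq_from_nth _ 0%N) => [|i].
  by rewrite size_map -cardE size_iota.
rewrite size_map -cardE => ilt; pose k : 'I_#|T| := Ordinal ilt.
rewrite (nth_map (enum_val k)) -?cardE // nth_iota // add0n -[i in LHS]/(val k).
by rewrite -(enum_val_nth (enum_val k)) enum_valK.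
Qed.

End Encodings.

Section Programs.

(* Programs are written in a de Bruijn style: the input is an environment
   [DCons d0 (DCons d1 ...)] in which [PVar n] reads [dn].  The body of a fold or
   a map sees the element as entry 0, the accumulator as entry 1 and the outer
   environment from entry 2 on. *)
Fixpoint PSkip (n : nat) : prog := if n is k.+1 then PComp (PSkip k) PTl else PId.
Definition PVar n := PComp PHd (PSkip n).
Definition PNil := PQuote DNil.
Definition PTrue := PQuote (enc_bool true).
Definition PLet e b := PComp b (PCons e PId).

Fixpoint data_nth n d := if n is k.+1 then data_nth k (tl_data d) else hd_data d.

Lemma ev_var n d : eval (PVar n) d (data_nth n d).
Proof.
apply: (@ev_comp _ _ _ (iter n tl_data d)); last first.
  have -> : data_nth n d = hd_data (iter n tl_data d) by elim: n d => //= n IH d; rewrite IH -iterSr.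
  exact: ev_hd.
elim: n d => [|n IH] d /=; first exact: ev_id.
by rewrite -iterS iterSr; exact: ev_comp (ev_tl _) (IH _).
Qed.

(** A computable semantics for programs without branches and loops, so that the handling of
    environments is settled by conversion. The junk value [DNil] is kept out by [is_straight]. *)
Fixpoint straight p d : data :=
  match p with
  | PId => d
  | PQuote c => c
  | PHd => hd_data d
  | PTl => tl_data d
  | PCons p1 p2 => DCons (straight p1 d) (straight p2 d)
  | PComp p1 p2 => straight p1 (straight p2 d)
  | _ => DNil
  end.

Fixpoint is_straight p : bool :=
  match p with
  | PIf _ _ _ | PWhile _ _ => false
  | PCons p1 p2 | PComp p1 p2 => is_straight p1 && is_straight p2
  | _ => true
  end.

Lemma ev_straight p d e : is_straight p -> straight p d = e -> eval p d e.
Proof.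
move=> hp <- {e}; elim: p d hp => //= [d _|c d _|d _|d _|p IHp q IHq d|p IHp q IHq d].
- exact: ev_id.
- exact: ev_quote.
- exact: ev_hd.
- exact: ev_tl.
- by case/andP=> hp hq; exact: ev_cons (IHp _ hp) (IHq _ hq).
- by case/andP=> hp hq; exact: ev_comp (IHq _ hq) (IHp _ hp).
Qed.

Lemma ev_let e b d x r : eval e d x -> eval b (DCons x d) r -> eval (PLet e b) d r.
Proof. by move=> he hb; apply: ev_comp hb; apply: ev_cons he (ev_id _). Qed.

Lemma ev_shift p x d r : eval p d r -> eval (PComp p PTl) (DCons x d) r.
Proof. exact: ev_comp (ev_tl (DCons x d)). Qed.

Lemma ev_if b p q d (c : bool) r :
  eval b d (enc_bool c) -> (c -> eval p d r) -> (~~ c -> eval q d r) ->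
  eval (PIf b p q) d r.
Proof.
case: c => hb hp hq; first exact: ev_if_true hb (hp isT).
exact: ev_if_false hb (hq isT).
Qed.

(** The loop state is [DCons acc (DCons rest env)]; the loop tests [rest], and the outer [PHd]
    returns [acc]. *)
Definition PFoldl body init lst :=
  PComp PHd (PComp
    (PWhile (PComp PHd PTl)
       (PCons (PComp body (PCons (PComp PHd (PComp PHd PTl)) (PCons PHd (PComp PTl PTl))))
              (PCons (PComp PTl (PComp PHd PTl)) (PComp PTl PTl))))
    (PCons init (PCons lst PId))).

Lemma ev_foldl (T U : Type) (encT : T -> data) (encU : U -> data) (f : U -> T -> U)
    body init lst env l u :
  eval init env (encU u) -> eval lst env (enc_seq encT l) ->
  (forall x a, eval body (DCons (encT x) (DCons (encU a) env)) (encU (f a x))) ->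
  eval (PFoldl body init lst) env (encU (foldl f u l)).
Proof.
move=> hi hl hb; rewrite /PFoldl.
apply: (@ev_comp _ _ _ (DCons (encU (foldl f u l)) (DCons DNil env))); last exact: ev_hd.
apply: ev_comp (ev_cons hi (ev_cons hl (ev_id _))) _ => {hi hl}.
elim: l u => [|x l IH] u /=.
  by apply: ev_while_false; exact: ev_comp (ev_tl _) (ev_hd _).
apply: ev_while_true (IH _); first exact: ev_comp (ev_tl _) (ev_hd _).
have h1 d : eval (PComp PHd PTl) d (hd_data (tl_data d)) by exact: ev_comp (ev_tl _) (ev_hd _).
have h2 d : eval (PComp PTl PTl) d (tl_data (tl_data d)) by exact: ev_comp (ev_tl _) (ev_tl _).
apply: ev_cons; last by apply: ev_cons (h2 _); exact: ev_comp (h1 _) (ev_tl _).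
apply: ev_comp _ (hb _ _); apply: ev_cons; first exact: ev_comp (h1 _) (ev_hd _).
exact: ev_cons (ev_hd _) (h2 _).
Qed.

Definition PRev := PFoldl (PCons (PVar 0) (PVar 1)) PNil.

Lemma ev_rev (T : Type) (enc : T -> data) lst env l :
  eval lst env (enc_seq enc l) -> eval (PRev lst) env (enc_seq enc (rev l)).
Proof.
have -> : rev l = foldl (fun a x => x :: a) [::] l.
  by rewrite -[in RHS](revK l) foldl_rev; elim: (rev l) => //= x s <-.
move=> h; apply: ev_foldl h _; first exact: ev_quote.
by move=> x a; exact: ev_cons (ev_var 0 _) (ev_var 1 _).
Qed.

Definition PFoldr body init lst := PFoldl body init (PRev lst).

Lemma ev_foldr (T U : Type) (encT : T -> data) (encU : U -> data) (f : T -> U -> U)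
    body init lst env l u :
  eval init env (encU u) -> eval lst env (enc_seq encT l) ->
  (forall x a, eval body (DCons (encT x) (DCons (encU a) env)) (encU (f x a))) ->
  eval (PFoldr body init lst) env (encU (foldr f u l)).
Proof.
move=> hi hl hb; rewrite -foldl_rev.
exact: (ev_foldl (f := fun a x => f x a)) hi (ev_rev hl) _.
Qed.

Definition PCat p q := PFoldr (PCons (PVar 0) (PVar 1)) q p.

Lemma ev_cat (T : Type) (enc : T -> data) p q env s t :
  eval p env (enc_seq enc s) -> eval q env (enc_seq enc t) ->
  eval (PCat p q) env (enc_seq enc (s ++ t)).
Proof.
move=> hp hq; have -> : s ++ t = foldr cons t s by elim: s {hp} => //= x s ->.
by apply: ev_foldr hq hp _ => x a; exact: ev_cons (ev_var 0 _) (ev_var 1 _).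
Qed.

Definition PMap body lst := PFoldr (PCons body (PVar 1)) PNil lst.

Lemma ev_map (T U : Type) (encT : T -> data) (encU : U -> data) (f : T -> U)
    body lst env l :
  eval lst env (enc_seq encT l) ->
  (forall x acc, eval body (DCons (encT x) (DCons acc env)) (encU (f x))) ->
  eval (PMap body lst) env (enc_seq encU (map f l)).
Proof.
move=> hl hb; apply: (ev_foldr (f := fun x a => f x :: a)) hl _; first exact: ev_quote.
by move=> x a; exact: ev_cons (hb _ _) (ev_var 1 _).
Qed.

Definition PFlatMap body lst := PFoldr (PCat body (PVar 1)) PNil lst.

Lemma ev_flatmap (T U : Type) (encT : T -> data) (encU : U -> data) (f : T -> seq U)
    body lst env l :
  eval lst env (enc_seq encT l) ->
  (forall x acc, eval body (DCons (encT x) (DCons acc env)) (enc_seq encU (f x))) ->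
  eval (PFlatMap body lst) env (enc_seq encU (flatten (map f l))).
Proof.
move=> hl hb.
have -> : flatten (map f l) = foldr (fun x a => f x ++ a) [::] l.
  by elim: l {hl} => //= x l ->.
apply: ev_foldr hl _; first exact: ev_quote.
by move=> x a; exact: ev_cat (hb _ _) (ev_var 1 _).
Qed.

(* The state is a flag together with a stack of pairs still to be compared. *)
Definition PEqBody :=
  let fst := PComp PHd (PComp PHd PTl) in
  let snd := PComp PTl (PComp PHd PTl) in
  let fail := PQuote (DCons DNil DNil) in
  PIf fst
    (PIf snd
       (PCons PHd
          (PCons (PCons (PComp PHd fst) (PComp PHd snd))
             (PCons (PCons (PComp PTl fst) (PComp PTl snd)) (PComp PTl PTl))))
       fail)
    (PIf snd fail (PCons PHd (PComp PTl PTl))).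

Definition PEqLoop := PWhile PTl PEqBody.

Definition PEq p q :=
  PComp PHd (PComp PEqLoop (PCons PTrue (PCons (PCons p q) PNil))).

(** Induction on [a] with an arbitrary stack: a successful comparison hands over to the rest of the
    stack, while a failed one clears both flag and stack, whence the fixed final state. *)
Lemma ev_eqloop a b f st r :
  (a = b -> eval PEqLoop (DCons f st) r ->
   eval PEqLoop (DCons f (DCons (DCons a b) st)) r) /\
  (a <> b -> eval PEqLoop (DCons f (DCons (DCons a b) st)) (DCons DNil DNil)).
Proof.
have hfst f0 a0 b0 st0 : eval (PComp PHd (PComp PHd PTl)) (DCons f0 (DCons (DCons a0 b0) st0)) a0.
  exact: ev_comp (ev_comp (ev_tl _) (ev_hd _)) (ev_hd _).
have hsnd f0 a0 b0 st0 : eval (PComp PTl (PComp PHd PTl)) (DCons f0 (DCons (DCons a0 b0) st0)) b0.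
  exact: ev_comp (ev_comp (ev_tl _) (ev_hd _)) (ev_tl _).
have hst f0 x0 st0 : eval (PComp PTl PTl) (DCons f0 (DCons x0 st0)) st0.
  exact: ev_comp (ev_tl _) (ev_tl _).
have stop : eval PEqLoop (DCons DNil DNil) (DCons DNil DNil).
  by apply: ev_while_false; exact: ev_tl.
have next f0 x0 st0 e r0 : eval PEqBody (DCons f0 (DCons x0 st0)) e ->
    eval PEqLoop e r0 -> eval PEqLoop (DCons f0 (DCons x0 st0)) r0.
  by move=> h; apply: (ev_while_true (t1 := x0) (t2 := st0)) h; exact: ev_tl.
elim: a b f st r => [|a1 IH1 a2 IH2] [|b1 b2] f st r; split=> //.
- move=> _; apply: next.
  apply: ev_if_false (hfst _ _ _ _) _; apply: ev_if_false (hsnd _ _ _ _) _.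
  exact: ev_cons (ev_hd _) (hst _ _ _).
- move=> _; apply: next stop.
  apply: ev_if_false (hfst _ _ _ _) _; apply: ev_if_true (hsnd _ _ _ _) _.
  exact: ev_quote.
- move=> _; apply: next stop.
  apply: ev_if_true (hfst _ _ _ _) _; apply: ev_if_false (hsnd _ _ _ _) _.
  exact: ev_quote.
all: move=> e; have step r' :
  eval PEqLoop (DCons f (DCons (DCons a1 b1) (DCons (DCons a2 b2) st))) r' ->
  eval PEqLoop (DCons f (DCons (DCons (DCons a1 a2) (DCons b1 b2)) st)) r'
  by apply: next;
     apply: ev_if_true (hfst _ _ _ _) _; apply: ev_if_true (hsnd _ _ _ _) _;
     apply: ev_cons (ev_hd _) _; apply: ev_cons;
     [apply: ev_cons; [exact: ev_comp (hfst _ _ _ _) (ev_hd _)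
     | exact: ev_comp (hsnd _ _ _ _) (ev_hd _)]
     |apply: ev_cons (hst _ _ _); apply: ev_cons; [exact: ev_comp (hfst _ _ _ _) (ev_tl _)
     | exact: ev_comp (hsnd _ _ _ _) (ev_tl _)]].
- by case: e => e1 e2 h; apply: step; apply: (IH1 _ _ _ _).1 => //; exact: (IH2 _ _ _ _).1.
- apply: step; case: (pselect (a1 = b1)) => [e1|ne1]; last by apply: (IH1 _ _ _ DNil).2.
  apply: (IH1 _ _ _ _).1 => //; apply: (IH2 _ _ _ DNil).2 => e2.
  by apply: e; rewrite e1 e2.
Qed.

Lemma ev_eq (T : eqType) (enc : T -> data) p q env x y :
  injective enc -> eval p env (enc x) -> eval q env (enc y) ->
  eval (PEq p q) env (enc_bool (x == y)).
Proof.
move=> inj hp hq; apply: (@ev_comp _ _ _ (DCons (enc_bool (x == y)) DNil)); last exact: ev_hd.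
apply: ev_comp (ev_cons (ev_quote _ _) (ev_cons (ev_cons hp hq) (ev_quote _ _))) _.
case: (eqVneq x y) => [->|ne].
  apply: (ev_eqloop _ _ _ _ _).1 => //.
  by apply: ev_while_false; exact: ev_tl.
by apply: (ev_eqloop _ _ _ _ DNil).2 => /inj/eqP; rewrite (negbTE ne).
Qed.

(* In [PMem] and [PIndex] the element is pushed first, so that the body of the
   fold finds it as entry 2. *)
Definition PMem x lst :=
  PLet x (PFoldr (PIf (PEq (PVar 0) (PVar 2)) PTrue (PVar 1)) PNil (PComp lst PTl)).

Lemma ev_mem (T : eqType) (enc : T -> data) x lst env z l :
  injective enc -> eval x env (enc z) -> eval lst env (enc_seq enc l) ->
  eval (PMem x lst) env (enc_bool (z \in l)).
Proof.
move=> inj hx hl; apply: ev_let hx _.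
have -> : (z \in l) = foldr (fun y b => if y == z then true else b) false l.
  elim: l {hl} => //= y l IH; rewrite in_cons IH eq_sym; by case: (y == z).
apply: (ev_foldr (encU := enc_bool)); [exact: ev_quote|exact: ev_shift hl|].
move=> y b; apply: (@ev_if _ _ _ _ (y == z)).
- by apply: ev_eq inj _ _; [exact: (ev_var 0)|exact: (ev_var 2)].
- by move=> ->; exact: ev_quote.
- by move=> /negbTE ->; exact: (ev_var 1).
Qed.

Definition PIndex x lst :=
  PLet x (PFoldr (PIf (PEq (PVar 0) (PVar 2)) PNil (PCons PNil (PVar 1))) PNil (PComp lst PTl)).

Lemma ev_index (T : eqType) (enc : T -> data) x lst env z l :
  injective enc -> eval x env (enc z) -> eval lst env (enc_seq enc l) ->
  eval (PIndex x lst) env (enc_nat (index z l)).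
Proof.
move=> inj hx hl; apply: ev_let hx _.
have -> : index z l = foldr (fun y n => if y == z then 0%N else n.+1) 0%N l.
  by elim: l {hl} => //= y l ->.
apply: (ev_foldr (encU := enc_nat)); [exact: ev_quote|exact: ev_shift hl|].
move=> y b; apply: (@ev_if _ _ _ _ (y == z)).
- by apply: ev_eq inj _ _; [exact: (ev_var 0)|exact: (ev_var 2)].
- by move=> ->; exact: ev_quote.
- by move=> /negbTE ->; exact: ev_cons (ev_quote _ _) (ev_var 1 _).
Qed.

(* A table over a finite type is the list of its entries in the order of [enum]. *)
Definition PLookup tbl x :=
  PComp PHd (PFoldl (PComp PTl (PVar 1)) tbl x).

(** An index is a unary number, hence a list of [DNil]; folding over it drops one table entry per
    unit. *)
Lemma ev_lookup (T : finType) (enc : T -> data) tbl p env (x : T) :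
  eval tbl env (enc_seq enc (enum T)) -> eval p env (enc_fin x) ->
  eval (PLookup tbl p) env (enc x).
Proof.
move=> ht; rewrite /enc_fin enc_nat_nseq => hp.
have e : foldl (fun s (_ : unit) => behead s) (enum T) (nseq (enum_rank x) tt) =
         x :: behead (drop (enum_rank x) (enum T)).
  have -> n (s : seq T) : foldl (fun s (_ : unit) => behead s) s (nseq n tt) = drop n s.
    by elim: n s => [|n IH] [|y s] //=; rewrite IH.
  rewrite (drop_nth x) ?nth_enum_rank //.
  by rewrite -cardE.
apply: (@ev_comp _ _ _ (enc_seq enc (x :: behead (drop (enum_rank x) (enum T))))).
  rewrite -e; apply: (ev_foldl (encU := enc_seq enc)) ht hp _ => y s.
  have -> : enc_seq enc (behead s) = tl_data (enc_seq enc s) by case: s.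
  exact: ev_comp (ev_var 1 _) (ev_tl _).
exact: ev_hd.
Qed.

Definition PIota lst := PFoldr (PCons PNil (PMap (PCons PNil (PVar 0)) (PVar 1))) PNil lst.

Lemma ev_iota (T : Type) (enc : T -> data) lst env l :
  eval lst env (enc_seq enc l) ->
  eval (PIota lst) env (enc_seq enc_nat (iota 0 (size l))).
Proof.
move=> hl.
have -> : iota 0 (size l) = foldr (fun _ s => 0%N :: map succn s) [::] l.
  by elim: l {hl} => //= _ l <-; rewrite -(iotaDl 1).
apply: ev_foldr hl _; first exact: ev_quote.
move=> x s; apply: ev_cons (ev_quote _ _) _.
apply: (@ev_map _ _ enc_nat enc_nat succn _ _ _ s); first exact: (ev_var 1).
move=> n acc.
exact: ev_cons (ev_quote _ _) (ev_var 0 _).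
Qed.

Lemma ev_enum (T : finType) (enc : T -> data) lst env :
  eval lst env (enc_seq enc (enum T)) ->
  eval (PIota lst) env (enc_seq (@enc_fin T) (enum T)).
Proof. by move/ev_iota; rewrite -cardE enc_enum. Qed.

Lemma ev_enum_card (T : finType) p env :
  eval p env (enc_nat #|T|) -> eval (PIota p) env (enc_seq (@enc_fin T) (enum T)).
Proof. by rewrite enc_nat_nseq => /ev_iota; rewrite size_nseq enc_enum. Qed.

End Programs.

Ltac straight := by apply: ev_straight; reflexivity.

(** * Paths in lists of labelled edges *)

Section Paths.
Variables (St L : eqType).

(** States may come from any type here, unlike in [aut_path], so edges and states can be added
    without renumbering. *)
Fixpoint epath (E : seq (St * L * St)) (s : St) (ls : seq L) (t : St) : Prop :=
  if ls is l :: ls' then exists2 s', (s, l, s') \in E & epath E s' ls' t else s = t.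

Lemma epath_cat E s ls1 ls2 t :
  epath E s (ls1 ++ ls2) t <-> exists2 s', epath E s ls1 s' & epath E s' ls2 t.
Proof.
elim: ls1 s => [|l ls1 IH] s /=; first by split=> [h|[s' ->]] //; exists s.
split=> [[s1 h1 /IH[s' h2 h3]]|[s' [s1 h1 h2] h3]].
  by exists s' => //; exists s1.
by exists s1 => //; apply/IH; exists s'.
Qed.

Lemma epath_sub (E E' : seq (St * L * St)) s ls t :
  {subset E <= E'} -> epath E s ls t -> epath E' s ls t.
Proof. by move=> sub; elim: ls s => //= l ls IH s [s' /sub h /IH h']; exists s'. Qed.

End Paths.

Lemma aut_pathP (L : eqType) (N : automaton L) p ls q :
  aut_path p ls q <-> epath (aut_edges N) p ls q.
Proof.
split; first by elim=> //= {}p l {}q {}ls r h _ IH; exists q.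
elim: ls p => [|l ls IH] p /=; first by move=> ->; exact: aut_path_nil.
by case=> s h /IH; exact: aut_path_cons.
Qed.

Lemma recognisedP (L : eqType) (M : monoidType) (f : L -> M) (N : automaton L) m :
  recognised (map_aut f N) m <->
  exists q ls, [/\ q \in aut_term N, epath (aut_edges N) (aut_init N) ls q & m = word_val f ls].
Proof.
split=> [[q [ls [hq /aut_pathP hp ->]]]|[q [ls [hq hp ->]]]].
  suff [ls' h' e] : exists2 ls', epath (aut_edges N) (aut_init N) ls' q & ls = map f ls'.
    by exists q, ls'; split=> //; rewrite e big_map.
  rewrite /= in hp; elim: ls (aut_init N) hp => [|l ls IH] s /=; first by move=> ->; exists [::].
  case=> s' /mapP[[[s1 l1] s1'] he [-> -> ->]] /IH[ls' h' ->].
  by exists (l1 :: ls') => //; exists s1'.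
exists q, (map f ls); split=> //; last by rewrite big_map.
apply/aut_pathP; rewrite /=; move: (aut_init N) hp => s; elim: ls s => [|l ls IH] s //= [s' h /IH h'].
by exists s' => //; apply/mapP; exists (s, l, s').
Qed.

Lemma word_val_flatten (X : Type) (M : monoidType) (gen : X -> M) (ls : seq (seq X)) :
  word_val gen (flatten ls) = word_val (word_val gen) ls.
Proof.
by elim: ls => [|l ls IH]; rewrite ?word_val_nil //= word_val_cat word_val_cons IH.
Qed.

(** * Queries to the vertex groups *)

Section VertexLabels.
Variables (Y : graph) (A : vert Y -> finType).

Definition vproj (v : vert Y) (l : letter A) : option (A v) :=
  match l with
  | inl _ => None
  | inr (existT u x) => if u =P v is ReflectT e then Some (ecast z (A z) e x) else None
  end.

Definition vlabel v (w : seq (letter A)) : bool := all (fun l => isSome (vproj v l)) w.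
Definition vword v (w : seq (letter A)) : seq (A v) := pmap (vproj v) w.

Lemma vproj_vletter v (x : A v) : vproj v (vletter (X := A) x) = Some x.
Proof. by rewrite /=; case: eqP => // e; rewrite (eq_axiomK e). Qed.

Lemma vlabel_map v (w : seq (A v)) : vlabel v (map (@vletter Y A v) w).
Proof. by apply/allP => l /mapP[x _ ->]; rewrite vproj_vletter. Qed.

Lemma vword_map v (w : seq (A v)) : vword v (map (@vletter Y A v) w) = w.
Proof. by apply: map_pK; exact: vproj_vletter. Qed.

Lemma vwordK v w : vlabel v w -> map (@vletter Y A v) (vword v w) = w.
Proof.
elim: w => //= -[y|[u x]] w IH //=; rewrite /vword /=; case: eqP => //= e.
by move=> /IH; rewrite /vword => {2}<-; case: v / e {IH}.
Qed.

Definition PVlabel w v :=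
  PLet v (PFoldr
    (PIf (PComp PHd (PVar 0))
      (PIf (PEq (PComp PHd (PComp PTl (PVar 0))) (PVar 2)) (PVar 1) PNil) PNil)
    PTrue (PComp w PTl)).

Definition PVword w v :=
  PLet v (PFoldr
    (PIf (PComp PHd (PVar 0))
      (PIf (PEq (PComp PHd (PComp PTl (PVar 0))) (PVar 2))
        (PCons (PComp PTl (PComp PTl (PVar 0))) (PVar 1)) (PVar 1)) (PVar 1))
    PNil (PComp w PTl)).

Lemma ev_vlabel pw pv env w (v : vert Y) :
  eval pw env (enc_seq (@enc_letter Y A) w) -> eval pv env (enc_fin v) ->
  eval (PVlabel pw pv) env (enc_bool (vlabel v w)).
Proof.
move=> hw hv; apply: ev_let hv _.
apply: (ev_foldr (encU := enc_bool) (f := fun l b => isSome (vproj v l) && b));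
  [exact: ev_quote|exact: ev_shift hw|].
move=> [y|[u x]] b.
  by apply: (@ev_if _ _ _ _ false) => // [|_]; straight.
apply: (@ev_if _ _ _ _ true) => // [|_]; first straight.
apply: (@ev_if _ _ _ _ (u == v)).
- by apply: (ev_eq (@enc_fin_inj (vert Y))); straight.
- by rewrite /=; case: eqP => //= e _; straight.
- by rewrite /=; case: eqP => //= e _; straight.
Qed.

Lemma enc_fin_cast u v (e : u = v) (x : A u) : enc_fin (ecast z (A z) e x) = enc_fin x.
Proof. by case: v / e. Qed.

Lemma ev_vword pw pv env w (v : vert Y) :
  eval pw env (enc_seq (@enc_letter Y A) w) -> eval pv env (enc_fin v) ->
  eval (PVword pw pv) env (enc_word (vword v w)).
Proof.
move=> hw hv; apply: ev_let hv _.
have -> : vword v w = foldr (fun l s => if vproj v l is Some x then x :: s else s) [::] w.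
  by elim: w {hw} => //= l w IH; rewrite /vword /=; case: (vproj v l) => /= [x|]; rewrite -IH.
apply: (ev_foldr (encU := @enc_word _)); [exact: ev_quote|exact: ev_shift hw|].
move=> [y|[u x]] s.
  by apply: (@ev_if _ _ _ _ false) => // [|_]; straight.
apply: (@ev_if _ _ _ _ true) => // [|_]; first straight.
apply: (@ev_if _ _ _ _ (u == v)).
- by apply: (ev_eq (@enc_fin_inj (vert Y))); straight.
- by rewrite /=; case: eqP => //= e _; apply: ev_straight => //; rewrite /= enc_fin_cast.
- by rewrite /=; case: eqP => //= e _; straight.
Qed.

End VertexLabels.

Definition PEsrc := PComp PHd (PVar 0).
Definition PElab := PComp PHd (PComp PTl (PVar 0)).
Definition PEtgt := PComp PTl (PComp PTl (PVar 0)).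

Section Query.
Variables (Y : graph) (G : graph_of_groups Y) (A : vert Y -> finType).
Variable a : forall v, A v -> vgrp G v.
Variables (St : eqType) (encSt : St -> data).
Hypothesis encSt_inj : injective encSt.
Implicit Types (E : seq (St * seq (letter A) * St)) (s t : St).

Definition enc_edge (e : St * seq (letter A) * St) : data :=
  DCons (encSt e.1.1) (DCons (enc_seq (@enc_letter Y A) e.1.2) (encSt e.2)).

Definition vertex_query v E s t (o : seq (A v)) : Prop :=
  exists ls w, [/\ epath E s ls t, flatten ls = map (@vletter Y A v) w
    & word_val (@a v) w = word_val (@a v) o].

Definition query_states E s t : seq St :=
  s :: t :: foldr (fun e acc => e.1.1 :: e.2 :: acc) [::] E.

Section QueryAutomaton.
Variables (v : vert Y) (E : seq (St * seq (letter A) * St)) (s t : St).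
Let Q := query_states E s t.

(** The last index, [size Q], is left to values outside [Q], so injectivity needs only one of the
    two arguments in [Q]. *)
Definition query_state (x : St) : 'I_(size Q).+1 := inord (index x Q).

Definition query_aut : automaton (seq (A v)) :=
  {| aut_init := query_state s;
     aut_term := [set query_state t];
     aut_edges := [seq (query_state e.1.1, vword v e.1.2, query_state e.2) |
                    e <- E & vlabel v e.1.2] |}.

Lemma query_state_inj x y : x \in Q -> query_state x = query_state y -> x = y.
Proof.
move=> hx /(congr1 val); rewrite /= !inordK ?ltnS ?index_size // => e.
have hy : y \in Q by rewrite -index_mem -e index_mem.
by rewrite -(nth_index x hx) e nth_index.
Qed.

Lemma query_states_tgt e : e \in E -> e.2 \in Q.
Proof.
rewrite /Q /query_states !in_cons => h; apply/orP; right; apply/orP; right.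
elim: E h => //= e' E' IH; rewrite !in_cons => /orP[/eqP ->|/IH ->].
  by rewrite eqxx orbT.
by rewrite !orbT.
Qed.

(** Dropping the edges with labels not over [A v] loses nothing: if a concatenation of labels is
    over [A v], so is each label. *)
Lemma query_autP (o : seq (A v)) :
  recognised (map_aut (word_val (@a v)) query_aut) (word_val (@a v) o) <->
  vertex_query E s t o.
Proof.
have edgeP x w y : (x, w, y) \in aut_edges query_aut <->
    exists2 e, e \in E & 
      [/\ vlabel v e.1.2, x = query_state e.1.1, w = vword v e.1.2 & y = query_state e.2].
  split=> [/mapP[e]|[e he [hl -> -> ->]]].
    by rewrite mem_filter => /andP[hl he] [-> -> ->]; exists e.
  by apply/mapP; exists e; rewrite // mem_filter hl.
rewrite recognisedP; split.
  case=> q [ws [/set1P -> hp eo]].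
  suff [ls hls [al ew]] : exists2 ls, epath E s ls t & all (vlabel v) ls /\ ws = map (vword v) ls.
    exists ls, (flatten ws); split=> //; last by rewrite eo word_val_flatten.
    rewrite ew; elim: ls al {hls ew} => //= l ls IH /andP[hl /IH ->].
    by rewrite map_cat vwordK.
  suff gen x : x \in Q -> epath (aut_edges query_aut) (query_state x) ws (query_state t) ->
      exists2 ls, epath E x ls t & all (vlabel v) ls /\ ws = map (vword v) ls.
    by apply: gen hp; rewrite mem_head.
  elim: ws x {hp eo} => [|w ws IH] x hx.
    by move=> /(query_state_inj hx) ->; exists [::].
  case=> y' /edgeP[e he [hl /(query_state_inj hx) ex -> ->]] hp.
  have [ls hls [al ->]] := IH _ (query_states_tgt he) hp.
  exists (e.1.2 :: ls); last by rewrite /= hl.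
  by exists e.2 => //; rewrite ex -!surjective_pairing.
case=> ls [w [hp ew eo]]; exists (query_state t), (map (vword v) ls).
have al : all (vlabel v) ls.
  have : vlabel v (flatten ls) by rewrite ew vlabel_map.
  by elim: ls {hp ew} => //= l ls IH; rewrite /vlabel all_cat => /andP[-> /IH ->].
have ew' : flatten (map (vword v) ls) = w.
  rewrite -[RHS]vword_map -ew /vword; elim: ls {hp ew al} => //= l ls ->.
  by rewrite pmap_cat.
split; first exact/set1P.
  suff gen x : epath E x ls t -> epath (aut_edges query_aut) (query_state x)
      (map (vword v) ls) (query_state t).
    exact: gen.
  elim: ls al x {hp ew ew'} => [|l ls IH] + x; first by move=> _ /= ->.
  case/andP=> hl al [y he hp]; exists (query_state y); last exact: IH.
  by apply/edgeP; exists (x, l, y).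
by rewrite -word_val_flatten ew' eo.
Qed.

End QueryAutomaton.

End Query.

(** The environment lists [v], [E], [s], [t], [o]. The count of states starts from [1] to match the
    extra index of [query_state]. *)
Definition PQueryBody h :=
  PLet (PCons (PVar 2) (PCons (PVar 3)
         (PFoldr (PCons PEsrc (PCons PEtgt (PVar 1))) PNil (PVar 1))))
    (PComp h (PCons (PVar 1) (PCons
      (PCons (PFoldr (PCons PNil (PVar 1)) (PQuote (enc_nat 1)) (PVar 0))
        (PCons (PIndex (PVar 3) (PVar 0))
          (PCons (PCons (PIndex (PVar 4) (PVar 0)) PNil)
             (PFoldr
               (PIf (PVlabel PElab (PVar 3))
                  (PCons (PCons (PIndex PEsrc (PVar 2))
                            (PCons (PVword PElab (PVar 3)) (PIndex PEtgt (PVar 2))))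
                         (PVar 1))
                  (PVar 1))
               PNil (PVar 2)))))
      (PVar 5)))).

Definition PQuery h v E s t o :=
  PComp (PQueryBody h) (PCons v (PCons E (PCons s (PCons t (PCons o PNil))))).

Section QueryProgram.
Variables (Y : graph) (G : graph_of_groups Y) (A : vert Y -> finType).
Variable a : forall v, A v -> vgrp G v.
Variables (St : eqType) (encSt : St -> data).
Hypothesis encSt_inj : injective encSt.
Variable h : prog.
Hypothesis hP : forall v (N : automaton (seq (A v))) (m : seq (A v)), exists b : bool,
  eval h (DCons (enc_fin v) (DCons (enc_aut N) (enc_word m))) (enc_bool b) /\
  (b <-> recognised (map_aut (word_val (@a v)) N) (word_val (@a v) m)).

Lemma ev_query pv pE ps pt po env v E s t (o : seq (A v)) :
  eval pv env (enc_fin v) -> eval pE env (enc_seq (enc_edge encSt) E) ->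
  eval ps env (encSt s) -> eval pt env (encSt t) -> eval po env (enc_word o) ->
  eval (PQuery h pv pE ps pt po) env (enc_bool `[< vertex_query a E s t o >]).
Proof.
move=> hv hE hs ht ho.
apply: ev_comp (ev_cons hv (ev_cons hE (ev_cons hs (ev_cons ht (ev_cons ho (ev_quote _ _)))))) _.
have [b [hb eb]] := hP (query_aut v E s t) o.
have -> : `[< vertex_query a E s t o >] = b.
  by apply/asboolP/idP => [/query_autP/eb|/eb/query_autP].
apply: (@ev_let _ _ _ (enc_seq encSt (query_states E s t))).
  apply: ev_cons; first straight.
  apply: ev_cons; first straight.
  apply: (ev_foldr (encT := enc_edge encSt) (encU := enc_seq encSt)); try straight.
  by move=> x acc; straight.
apply: ev_comp _ hb; apply: ev_cons; first straight.
apply: ev_cons; last straight.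
have idx p env' x : eval p env' (encSt x) -> forall pQ,
   eval pQ env' (enc_seq encSt (query_states E s t)) ->
   eval (PIndex p pQ) env' (enc_fin (query_state E s t x)).
  move=> hp pQ hQ; rewrite enc_fin_ord inordK ?ltnS ?index_size //.
  exact: ev_index encSt_inj hp hQ.
apply: ev_cons.
  rewrite [aut_size _](_ : _ = foldr (fun _ n => n.+1) 1%N (query_states E s t)).
    by apply: (ev_foldr (encT := encSt)) => [||x n]; straight.
  by rewrite [LHS]/aut_size /query_aut; elim: (query_states E s t) => //= x l <-.
apply: ev_cons; first by apply: idx; straight.
apply: ev_cons.
  rewrite /= enum_set1; apply: ev_cons; last straight.
  by apply: idx; straight.
have foldr_filter (T U : Type) (p : pred T) (f : T -> U) l :
    [seq f x | x <- l & p x] = foldr (fun x acc => if p x then f x :: acc else acc) [::] l.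
  by elim: l => //= x l <-; case: (p x).
rewrite [aut_edges _]foldr_filter.
apply: (@ev_foldr _ _ (enc_edge encSt) _ _ _ _ _ _ E [::]); try straight.
move=> e acc; apply: (@ev_if _ _ _ _ (vlabel v e.1.2)).
- by apply: ev_vlabel; straight.
- move=> ->; apply: ev_cons; last straight.
  apply: ev_cons; first by apply: idx; straight.
  apply: ev_cons; first by apply: ev_vword; straight.
  by apply: idx; straight.
- by move=> /negbTE ->; straight.
Qed.

End QueryProgram.

Lemma enc_letter_inj (Y : graph) (A : vert Y -> finType) : injective (@enc_letter Y A).
Proof.
move=> [y|[u x]] [z|[v w]] //=; first by case=> /enc_fin_inj ->.
by case=> /enc_fin_inj e; case: v / e w => w /enc_fin_inj ->.
Qed.

Lemma enc_edge_inj (Y : graph) (A : vert Y -> finType) (St : eqType) (encSt : St -> data) :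
  injective encSt -> injective (@enc_edge Y A St encSt).
Proof.
move=> inj [[s l] t] [[s' l'] t'] [/inj /= -> /(enc_seq_inj (@enc_letter_inj Y A)) -> /inj ->].
by [].
Qed.

(** * Saturation *)

(** At most one edge is returned; all rules are tried again after it has been added. *)
Definition PMissing h :=
  let new := PComp PTl (PComp PTl (PComp PTl (PComp PTl (PVar 0)))) in
  PFoldr
    (PIf (PMem new (PVar 2)) (PVar 1)
       (PIf (PQuery h (PComp (PVar 0) (PVar 0)) (PVar 2) (PComp (PVar 2) (PVar 0))
               (PComp (PVar 3) (PVar 0)) (PComp (PVar 1) (PVar 0)))
          (PCons new PNil) (PVar 1)))
    PNil (PVar 1).

Definition PSaturate h :=
  PWhile (PMissing h) (PCons (PCons (PComp PHd (PMissing h)) (PVar 0)) PTl).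

Section Saturation.
Variables (Y : graph) (G : graph_of_groups Y) (A : vert Y -> finType).
Variable a : forall v, A v -> vgrp G v.
Variables (St : eqType) (encSt : St -> data).
Hypothesis encSt_inj : injective encSt.
Variable h : prog.
Hypothesis hP : forall v (N : automaton (seq (A v))) (m : seq (A v)), exists b : bool,
  eval h (DCons (enc_fin v) (DCons (enc_aut N) (enc_word m))) (enc_bool b) /\
  (b <-> recognised (map_aut (word_val (@a v)) N) (word_val (@a v) m)).

Let edges := seq (St * seq (letter A) * St).

(* [(v, o), (s, t), e]: the edge [e] is to be added as soon as some path from
   [s] to [t] over [A v] spells [o]. *)
Definition rule : eqType :=
  ({v : vert Y & seq (A v)} * (St * St) * (St * seq (letter A) * St))%type.

Definition enc_rule (c : rule) : data :=
  DCons (enc_fin (tag c.1.1)) (DCons (enc_word (tagged c.1.1))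
    (DCons (encSt c.1.2.1) (DCons (encSt c.1.2.2) (enc_edge encSt c.2)))).

Definition rule_applies (c : rule) (E : edges) : Prop :=
  vertex_query a E c.1.2.1 c.1.2.2 (tagged c.1.1).

Definition missing (C : seq rule) (E : edges) : edges :=
  foldr (fun c acc => if c.2 \in E then acc else
                      if `[< rule_applies c E >] then [:: c.2] else acc) [::] C.

Lemma missing_nil C E c :
  missing C E = [::] -> c \in C -> rule_applies c E -> c.2 \in E.
Proof.
elim: C => //= d C IH; rewrite in_cons => hm /orP[/eqP ->|hc] hr.
  by move: hm; case: ifP => // _; case: asboolP.
by apply: IH hc hr; move: hm; case: ifP => // _; case: asboolP.
Qed.

Lemma missing_cons C E e r :
  missing C E = e :: r ->
  exists c, [/\ c \in C, rule_applies c E, e = c.2 & c.2 \notin E].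
Proof.
elim: C => //= d C IH; case: ifPn => [_|hn].
  by case/IH=> c [hc hr he hE]; exists c; rewrite in_cons hc orbT.
case: asboolP => [hr [<- _]|_]; first by exists d; rewrite mem_head.
by case/IH=> c [hc hr' he hE]; exists c; rewrite in_cons hc orbT.
Qed.

Lemma ev_missing C E env :
  eval (PMissing h) (DCons (enc_seq (enc_edge encSt) E) (DCons (enc_seq enc_rule C) env))
    (enc_seq (enc_edge encSt) (missing C E)).
Proof.
apply: (ev_foldr (encT := enc_rule)); try straight.
move=> c acc; apply: (@ev_if _ _ _ _ (c.2 \in E)).
- by apply: (ev_mem (enc_edge_inj encSt_inj)); straight.
- by move=> ->; straight.
move=> /negbTE ->; apply: (@ev_if _ _ _ _ `[< rule_applies c E >]).
- by apply: (ev_query encSt_inj hP); straight.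
- by move=> ->; straight.
- by move=> /negbTE ->; straight.
Qed.

(** Each round adds a conclusion that was absent, and the list of rules stays fixed, so the number
    of rules with an absent conclusion decreases strictly. *)
Lemma ev_saturate (inv : edges -> Prop) C E env :
  inv E ->
  (forall E1 c, inv E1 -> c \in C -> rule_applies c E1 -> inv (c.2 :: E1)) ->
  exists E', [/\
    eval (PSaturate h)
      (DCons (enc_seq (enc_edge encSt) E) (DCons (enc_seq enc_rule C) env))
      (DCons (enc_seq (enc_edge encSt) E') (DCons (enc_seq enc_rule C) env)),
    inv E' & forall c, c \in C -> rule_applies c E' -> c.2 \in E'].
Proof.
move=> invE step; have [n] := ubnP (count (fun c : rule => c.2 \notin E) C).
elim: n E invE => // n IH E invE hn.
have hev := ev_missing C E env.
case em: (missing C E) hev => [|e r] hev.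
  exists E; split=> //; first exact: ev_while_false.
  by move=> c; exact: missing_nil em.
have [c [hc hr ee ne]] := missing_cons em.
have [||E' [hE' inv' cl]] := IH (e :: E).
- by rewrite ee; exact: step.
- rewrite ltnS in hn; apply: leq_trans hn.
  elim: C hc {hev em IH step} => //= d C IHC; rewrite in_cons => /orP[/eqP <-|hc].
    rewrite ee mem_head /= ne /= add0n ltnS; apply: sub_count => x.
    by rewrite in_cons negb_or => /andP[].
  rewrite -addnS; apply: leq_add; last exact: IHC.
  by rewrite in_cons negb_or; case: (_ \notin E); rewrite ?andbF ?leq_b1.
exists E'; split=> //.
apply: ev_while_true hev _ hE'; apply: ev_cons; last straight.
apply: ev_cons; last straight.
by have := ev_comp (ev_missing C E env) (ev_hd _); rewrite em.
Qed.

End Saturation.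

(* [PGog k p] is the [k]-th component of the description of a graph of groups
   computed by [p], see [enc_gog]. *)
Definition PGog k p := PComp (PVar k) p.

(** * Deciding whether a rational subset contains the identity *)

Definition PExpand :=
  PFlatMap
    (PLet (PFlatMap (PLookup (PGog 5 (PVar 7)) (PVar 0)) (PComp PHd (PComp PTl (PVar 0))))
      (PCons
         (PCons (PCons (PComp PHd (PVar 1)) PNil)
            (PCons PNil (PCons (PComp PTl (PComp PTl (PVar 1))) (PVar 0))))
         (PComp PTl (PFoldr
            (PLet (PCons (PVar 0) (PComp PHd (PVar 1)))
               (PCons (PVar 0)
                  (PCons
                     (PCons (PCons (PComp PTl (PComp PTl (PVar 4))) (PVar 0))
                        (PCons (PCons (PVar 1) PNil)
                           (PCons (PComp PTl (PComp PTl (PVar 4))) (PComp PHd (PVar 2)))))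
                     (PComp PTl (PVar 2)))))
            (PCons PNil PNil) (PVar 0)))))
    (PVar 0).

Definition PRules :=
  let rowtable g := PComp PTl (PGog 0 g) in
  let edge_word y := PCons (PCons PNil y) PNil in
  let src e := PComp PHd e in
  let lab e := PComp PHd (PComp PTl e) in
  let tgt e := PComp PTl (PComp PTl e) in
  PFlatMap
    (PLet (PLookup (rowtable (PVar 6)) (PVar 0))
      (PFlatMap
        (PFlatMap
          (PIf (PEq (lab (PVar 2)) (edge_word (PVar 5)))
             (PIf (PEq (lab (PVar 0)) (edge_word (PComp (PVar 2) (PVar 4))))
                (PMap
                   (PCons (PComp (PVar 1) (PVar 6))
                      (PCons (PComp PTl (PVar 0))
                         (PCons (tgt (PVar 4))
                            (PCons (src (PVar 2))
                               (PCons (src (PVar 4))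
                                  (PCons
                                     (PMap (PCons (PQuote (DCons DNil DNil))
                                                  (PCons (PComp (PVar 0) (PVar 8)) (PVar 0)))
                                        (PComp PHd (PVar 0)))
                                     (tgt (PVar 2))))))))
                   (PLookup (PGog 4 (PVar 11)) (PVar 5)))
                PNil)
             PNil)
          (PVar 5))
        (PVar 3)))
    (PIota (rowtable (PVar 4))).

(* The environment holds an automaton given by its edges, its initial and its
   terminal state, and the description of the graph of groups. *)
Definition POne h :=
  PLet PExpand
    (PLet PRules
       (PQuery h (PGog 1 (PVar 5))
          (PComp PHd (PComp (PSaturate h) (PCons (PVar 1) (PCons (PVar 0) PNil))))
          (PCons (PVar 3) PNil) (PCons (PVar 4) PNil) PNil)).

Section OneMembership.
Variables (Y : graph) (G : graph_of_groups Y) (X : vert Y -> choiceType).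
Variable P : forall v : vert Y, monoid_pres (vgrp G v) (X v).
Variables (A : vert Y -> finType) (a : forall v, A v -> vgrp G v).
Variables (v0 : vert Y) (S : finType) (gen : S -> pi1 P v0) (D : gog_data G A S).
Hypothesis alphaP : forall y g, word_val (@a (src y)) (d_alpha D g) = alpha G y g.
Hypothesis omegaP : forall y g, word_val (@a (tgt y)) (d_omega D g) = omega G y g.
Hypothesis gen_typed : forall s, typed_word v0 (d_gen D s) v0.
Hypothesis genP : forall s, val (gen s) = word_val (letter_val P a) (d_gen D s).

Let St : eqType := (nat * seq (letter A))%type.
Let lval := word_val (letter_val P a).
Let expand_word (w : seq S) := flatten (map (d_gen D) w).

Definition enc_state (s : nat * seq (letter A)) : data :=
  DCons (enc_nat s.1) (enc_seq (@enc_letter Y A) s.2).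

Lemma enc_state_inj : injective enc_state.
Proof.
by move=> [n w] [m z] [/enc_nat_inj /= -> /(enc_seq_inj (@enc_letter_inj Y A)) ->].
Qed.

Lemma val_word_val w : val (word_val gen w) = lval (expand_word w).
Proof.
elim: w => [|x w IH]; first by rewrite /lval !word_val_nil.
by rewrite word_val_cons valM IH genP /lval -word_val_cat.
Qed.

Lemma expand_typed w : typed_word v0 (expand_word w) v0.
Proof.
elim: w => [|x w IH] /=; first exact: eqxx.
by apply/typed_word_cat; exists v0.
Qed.

(* [(q, w)] is the state from which [w] has to be read before reaching [q]. *)
Fixpoint suffix_edges (q : nat) (w : seq (letter A)) : seq (St * seq (letter A) * St) :=
  if w is l :: w' then ((q, w), [:: l], (q, w')) :: suffix_edges q w' else [::].

(** Different edges may share states [(q, w)]. This creates no new words, since such a state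
    determines what is read before [q] is reached. *)
Definition expand (es : seq (nat * seq S * nat)) : seq (St * seq (letter A) * St) :=
  flatten [seq ((e.1.1, [::]), [::], (e.2, expand_word e.1.2)) ::
               suffix_edges e.2 (expand_word e.1.2) | e <- es].

Lemma suffix_edgesP q w e :
  e \in suffix_edges q w -> exists l w', e = ((q, l :: w'), [:: l], (q, w')).
Proof.
elim: w => //= l w IH; rewrite in_cons => /orP[/eqP ->|/IH //]; by exists l, w.
Qed.

Lemma suffix_path E q w :
  {subset suffix_edges q w <= E} ->
  exists2 ls, epath E (q, w) ls (q, [::]) & flatten ls = w.
Proof.
elim: w => [|l w IH] /= sub; first by exists [::].
have [e he|ls hls e] := IH; first by apply: sub; rewrite in_cons he orbT.
exists ([:: l] :: ls); last by rewrite /= e.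
by exists (q, w) => //; apply: sub; rewrite mem_head.
Qed.

Lemma expand_complete es p ws q :
  epath es p ws q ->
  exists2 ls, epath (expand es) (p, [::]) ls (q, [::]) & flatten ls = expand_word (flatten ws).
Proof.
elim: ws p => [|w ws IH] p /=; first by move=> ->; exists [::].
case=> s he /IH[ls2 h2 e2].
have sub : {subset
    ((p, [::]), [::], (s, expand_word w)) :: suffix_edges s (expand_word w) <= expand es}.
  by move=> e hin; apply/flatten_mapP; exists (p, w, s).
have [e hin|ls1 h1 e1] := @suffix_path (expand es) s (expand_word w).
  by apply: sub; rewrite in_cons hin orbT.
exists ([::] :: ls1 ++ ls2).
  exists (s, expand_word w); first by apply: sub; rewrite mem_head.
  by apply/epath_cat; exists (s, [::]).
by rewrite /= flatten_cat e1 e2 /expand_word map_cat flatten_cat.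
Qed.

Lemma expand_sound es p w ls q :
  epath (expand es) (p, w) ls (q, [::]) ->
  exists2 ws, epath es p ws q & flatten ls = w ++ expand_word (flatten ws).
Proof.
elim: ls p w => [|l ls IH] p w /=; first by case=> -> ->; exists [::].
case=> -[p' w'] /flatten_mapP[[[p1 w1] q1] he]; rewrite in_cons => /orP[/eqP[-> -> -> -> ->]|].
  case/IH=> ws h ->; exists (w1 :: ws); first by exists q1.
  by rewrite /= /expand_word map_cat flatten_cat.
by case/suffix_edgesP=> l' [w2 [-> -> -> -> ->]] /IH[ws h ->]; exists ws.
Qed.

(** The shortcut for a path through [e1], a word of value [omega_y g], and [e2], intended for edges
    that read [y] and [bar y]. *)
Definition edge_rule (y : edge Y) (g : egrp G y) (e1 e2 : St * seq (letter A) * St) : rule A St :=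
  (existT (fun v => seq (A v)) (tgt y) (d_omega D g), (e1.2, e2.1.1),
   (e1.1.1, map (@vletter Y A (src y)) (d_alpha D g), e2.2)).

Definition rules (E : seq (St * seq (letter A) * St)) : seq (rule A St) :=
  flatten [seq flatten [seq flatten [seq
    (if (e1.1.2 == [:: eletter A y]) && (e2.1.2 == [:: eletter A (bar y)])
     then [seq edge_rule g e1 e2 | g <- enum (egrp G y)] else [::])
    | e2 <- E] | e1 <- E] | y <- enum (edge Y)].

Lemma rulesP E c :
  c \in rules E <-> exists y (g : egrp G y) e1 e2,
    [/\ e1 \in E, e2 \in E, e1.1.2 = [:: eletter A y], e2.1.2 = [:: eletter A (bar y)]
      & c = edge_rule g e1 e2].
Proof.
split.
  case/flatten_mapP=> y _ /flatten_mapP[e1 h1 /flatten_mapP[e2 h2]].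
  case: ifP => // /andP[/eqP l1 /eqP l2] /mapP[g _ ->].
  by exists y, g, e1, e2.
case=> y [g [e1 [e2 [h1 h2 l1 l2 ->]]]].
apply/flatten_mapP; exists y; first by rewrite mem_enum.
apply/flatten_mapP; exists e1 => //; apply/flatten_mapP; exists e2 => //.
by rewrite l1 l2 !eqxx /=; apply/mapP; exists g; rewrite // mem_enum.
Qed.

(** Under this condition an edge letter read along a path is a whole label, so the path can be cut
    right before and after it. *)
Definition good_label (l : seq (letter A)) : Prop :=
  (exists y, l = [:: eletter A y]) \/ forall y, inl y \notin l.

Lemma expand_good es e : e \in expand es -> good_label e.1.2.
Proof.
case/flatten_mapP=> -[[p w] q] _; rewrite in_cons => /orP[/eqP ->|]; first by right.
case/suffix_edgesP=> -[y|x] [w' ->]; first by left; exists y.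
by right=> y.
Qed.

(* The invariant of saturation. *)
Definition abbreviates (E0 E : seq (St * seq (letter A) * St)) : Prop :=
  {subset E0 <= E} /\ forall e, e \in E ->
    good_label e.1.2 /\
    exists2 ls, epath E0 e.1.1 ls e.2 & lval (flatten ls) = lval e.1.2.

Lemma abbreviates_path E0 E s ls t :
  abbreviates E0 E -> epath E s ls t ->
  exists2 ls', epath E0 s ls' t & lval (flatten ls') = lval (flatten ls).
Proof.
case=> _ sound; elim: ls s => [|l ls IH] s /=; first by move=> ->; exists [::].
case=> s' /sound[_ [ls1 h1 e1]] /IH[ls2 h2 e2].
exists (ls1 ++ ls2); first by apply/epath_cat; exists s'.
by rewrite flatten_cat /lval !word_val_cat -/lval e1 e2.
Qed.

Lemma lval_redex y (g : egrp G y) (o : seq (A (tgt y))) w :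
  word_val (@a (tgt y)) o = omega G y g ->
  lval (eletter A y :: map (@vletter Y A (tgt y)) o ++ eletter A (bar y) :: w) =
  lval (map (@vletter Y A (src y)) (d_alpha D g) ++ w).
Proof.
move=> eo; rewrite /lval word_val_cons !word_val_cat word_val_cons.
by rewrite !letter_val_vertex eo alphaP -(stable_conj P g) !mulgA.
Qed.

Lemma abbreviates_step E0 E c :
  abbreviates E0 E -> c \in rules E0 -> rule_applies a c E -> abbreviates E0 (c.2 :: E).
Proof.
move=> inv /rulesP[y [g [[[s1 l1] s2] [[[s3 l3] s4] [h1 h2 /= e1 e2 ->]]]]].
case=> ls [w [/= hp ew eo]]; have [sub sound] := inv; split=> [e /sub he|e].
  by rewrite in_cons he orbT.
rewrite in_cons => /orP[/eqP ->|/sound //]; split=> /=.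
  by right=> z; apply/negP => /mapP[].
have [ls' hp' el] := abbreviates_path inv hp.
subst l1 l3; exists ([:: eletter A y] :: ls' ++ [:: [:: eletter A (bar y)]]).
  exists s2 => //; apply/epath_cat; exists s3 => //=.
  by exists s4.
rewrite /= flatten_cat /= -[RHS](congr1 lval (cats0 _)) -(@lval_redex _ _ w) ?eo //.
by rewrite /lval /= word_val_cons (word_val_cons _ (eletter A y)) !word_val_cat -/lval el ew.
Qed.

Lemma epath_split (E : seq (St * seq (letter A) * St)) s ls t w1 y w2 :
  (forall e, e \in E -> good_label e.1.2) -> epath E s ls t ->
  flatten ls = w1 ++ eletter A y :: w2 ->
  exists ls1 ls2 s1 s2,
    [/\ epath E s ls1 s1, (s1, [:: eletter A y], s2) \in E, epath E s2 ls2 t,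
        flatten ls1 = w1 & flatten ls2 = w2].
Proof.
move=> good; elim: ls s w1 => [|l ls IH] s w1 /=; first by case: w1.
case=> s' he hp ew.
have [[z /= el]|/= no] := good _ he.
  subst l; case: w1 ew => [[ez ew]|x w1 [<- ew]].
    by exists [::], ls, s, s'; split=> //; rewrite -?ez.
  have [ls1 [ls2 [s1 [s2 [h1 h2 h3 <- <-]]]]] := IH _ _ hp ew.
  by exists ([:: eletter A z] :: ls1), ls2, s1, s2; split=> //; exists s'.
(* The label [l] has no edge letter, so it ends before the distinguished [y]. *)
have [w1' ew1] : exists w1', w1 = l ++ w1'.
  elim: l w1 {he IH} no ew => [|x l IHl] w1 no /= ew; first by exists w1.
  case: w1 ew => [[ex _]|z w1 [-> ew]].
    by have := no y; rewrite ex mem_head.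
  have [|w1' ->] := IHl w1 _ ew; last by exists w1'.
  by move=> z'; have := no z'; rewrite in_cons negb_or => /andP[].
move: ew; rewrite ew1 -catA => /eqP; rewrite eqseq_cat // eqxx /= => /eqP ew.
have [ls1 [ls2 [s1 [s2 [h1 h2 h3 <- <-]]]]] := IH _ _ hp ew.
by exists (l :: ls1), ls2, s1, s2; split=> //; exists s'.
Qed.

Let is_edge (l : letter A) : bool := if l is inl _ then true else false.

(** Induction on the number of edge letters. Britton's lemma yields either a word over [A v0], which
    answers the query, or a factor whose shortcut removes two edge letters and preserves value and
    typing. *)
Lemma saturated_complete E0 E s ls t :
  abbreviates E0 E ->
  (forall c, c \in rules E0 -> rule_applies a c E -> c.2 \in E) ->
  (forall e y, e \in E -> e.1.2 = [:: eletter A y] -> e \in E0) ->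
  epath E s ls t -> typed_word v0 (flatten ls) v0 -> lval (flatten ls) = 1 ->
  vertex_query a E s t ([::] : seq (A v0)).
Proof.
move=> inv closed old.
have good e : e \in E -> good_label e.1.2 by case/(inv.2).
have [n] := ubnP (count is_edge (flatten ls)).
elim: n ls => // n IH ls hn hp ty e1.
have [[w0 [ew e0]]|[w1 [y [o [g [w2 [ew eo]]]]]]] := britton ty e1.
  by exists ls, w0; split=> //; rewrite e0 word_val_nil.
have [ls1 [ls' [s1 [s2 [h1 h2 h3 el1 el']]]]] := epath_split good hp ew.
have [ls2 [ls3 [s3 [s4 [h4 h5 h6 el2 el3]]]]] := epath_split good h3 el'.
(* By [old], both edges belong to [E0], from which the rules were computed. *)
have hr : edge_rule g (s1, [:: eletter A y], s2) (s3, [:: eletter A (bar y)], s4) \in rules E0.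
  apply/rulesP; exists y, g; do 2!eexists; split; last reflexivity; try by [].
  - exact: old h2 _.
  - exact: old h5 _.
have hE := closed _ hr.
have {hE}hE : (s1, map (@vletter Y A (src y)) (d_alpha D g), s4) \in E.
  by apply: hE; exists ls2, o; split=> //=; rewrite omegaP eo.
apply: (IH (ls1 ++ map (@vletter Y A (src y)) (d_alpha D g) :: ls3)).
- rewrite ltnS in hn; apply: leq_trans hn.
  rewrite ew flatten_cat /= el1 el3 !count_cat /= !count_cat /=.
  have no v (w : seq (A v)) : count is_edge (map (@vletter Y A v) w) = 0%N.
    by elim: w.
  by rewrite !no !add0n !add1n !addnS ltnS leqnSn.
- by apply/epath_cat; exists s1 => //; exists s4.
- rewrite flatten_cat /= el1 el3; move: ty; rewrite ew => /typed_word_cat[v h].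
  rewrite /= => /andP[/eqP sv] /typed_word_cat[u]; rewrite typed_word_vertex.
  case/andP=> /eqP tu _ /= /andP[_ h']; apply/typed_word_cat; exists v => //.
  apply/typed_word_cat; exists v; first by rewrite typed_word_vertex eqxx (introT eqP sv) orbT.
  by rewrite -sv src_bar.
- rewrite flatten_cat /= el1 el3 -e1 ew /lval !(word_val_cat _ w1); congr (_ * _).
  by rewrite -/lval (lval_redex _ eo).
Qed.

Definition enc_sedge (e : nat * seq S * nat) : data :=
  DCons (enc_nat e.1.1) (DCons (enc_word e.1.2) (enc_nat e.2)).

Let enc_es := enc_seq enc_sedge.
Let enc_E := enc_seq (@enc_edge Y A St enc_state).
Let enc_w := enc_seq (@enc_letter Y A).

Lemma ev_expand es i t env :
  eval PExpand (DCons (enc_es es) (DCons i (DCons t (DCons (enc_gog v0 D) env))))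
    (enc_E (expand es)).
Proof.
apply: (ev_flatmap (encT := enc_sedge)); first straight.
move=> [[p w] q] acc; apply: (@ev_let _ _ _ (enc_w (expand_word w))).
  apply: (ev_flatmap (encT := @enc_fin S)); first straight.
  move=> x acc'; apply: (@ev_lookup S (fun s => enc_w (d_gen D s))); straight.
rewrite /enc_E /=; apply: ev_cons; first straight.
set lw := expand_word w.
have -> : enc_seq (enc_edge enc_state) (suffix_edges q lw) =
    tl_data (DCons (enc_w lw) (enc_E (suffix_edges q lw))) by [].
apply: ev_comp (ev_tl _).
(* The fold sees one letter at a time, so its accumulator carries the suffix along with the edges;
   the suffix is discarded at the end. *)
pose f l (b : seq (letter A) * seq (St * seq (letter A) * St)) :=
  (l :: b.1, ((q, l :: b.1), [:: l], (q, b.1)) :: b.2).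
pose enc_b (b : seq (letter A) * seq (St * seq (letter A) * St)) :=
  DCons (enc_w b.1) (enc_E b.2).
have -> : DCons (enc_w lw) (enc_E (suffix_edges q lw)) = enc_b (foldr f ([::], [::]) lw).
  have -> : foldr f ([::], [::]) lw = (lw, suffix_edges q lw); last by [].
  by elim: (lw) => //= l z ->.
apply: (ev_foldr (encT := @enc_letter Y A) (encU := enc_b)); try straight.
by move=> l [z E]; apply: ev_let; straight.
Qed.

Lemma ev_rules E es i t env :
  eval PRules (DCons (enc_E E) (DCons es (DCons i (DCons t (DCons (enc_gog v0 D) env)))))
    (enc_seq (enc_rule enc_state) (rules E)).
Proof.
pose row y := enc_list [:: enc_fin (src y); enc_fin (tgt y); enc_fin (@bar Y y)].
apply: (ev_flatmap (encT := @enc_fin (edge Y))).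
  by apply: (@ev_enum (edge Y) row); straight.
move=> y acc1; apply: (@ev_let _ _ _ (row y)).
  by apply: (@ev_lookup (edge Y) row); straight.
apply: (ev_flatmap (encT := @enc_edge Y A St enc_state)); first straight.
move=> e1 acc2.
apply: (ev_flatmap (encT := @enc_edge Y A St enc_state)); first straight.
move=> e2 acc3; have winj := enc_seq_inj (@enc_letter_inj Y A).
apply: (@ev_if _ _ _ _ (e1.1.2 == [:: eletter A y])).
- by apply: (ev_eq winj); straight.
- move=> ->; apply: (@ev_if _ _ _ _ (e2.1.2 == [:: eletter A (bar y)])).
  + by apply: (ev_eq winj); straight.
  + move=> ->.
    pose row' g := DCons (enc_word (d_alpha D g)) (enc_word (d_omega D (y := y) g)).
    apply: (ev_map (encT := row')).
      apply: (@ev_lookup (edge Y) (fun y => enc_seq (fun g : egrp G y =>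
               DCons (enc_word (d_alpha D g)) (enc_word (d_omega D g))) (enum (egrp G y)))); straight.
    move=> g acc4; do 5!(apply: ev_cons; first straight).
    apply: ev_cons; last straight.
    apply: (ev_map (encT := @enc_fin (A (src y)))); first straight.
    by move=> x acc5; straight.
  + by move=> /negbTE ->; straight.
- by move=> /negbTE ->; straight.
Qed.

Variable h : prog.
Hypothesis hP : forall v (N : automaton (seq (A v))) (m : seq (A v)), exists b : bool,
  eval h (DCons (enc_fin v) (DCons (enc_aut N) (enc_word m))) (enc_bool b) /\
  (b <-> recognised (map_aut (word_val (@a v)) N) (word_val (@a v) m)).

Lemma ev_one es i t env :
  eval (POne h)
    (DCons (enc_es es) (DCons (enc_nat i) (DCons (enc_nat t) (DCons (enc_gog v0 D) env))))
    (enc_bool `[< exists2 ws, epath es i ws t & word_val gen (flatten ws) = 1 >]).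
Proof.
apply: ev_let (ev_expand _ _ _ _) _; apply: ev_let (ev_rules _ _ _ _ _) _.
(* The second half of the invariant says that saturation creates no edge labelled by a single edge
   letter, so the rules computed from [E0] stay complete. *)
set E0 := expand es; pose inv E := abbreviates E0 E /\
  forall e y, e \in E -> e.1.2 = [:: eletter A y] -> e \in E0.
have inv0 : inv E0.
  split=> //; split=> // -[[s l] s'] he; split; first exact: expand_good he.
  by exists [:: l]; [exists s' | rewrite /= cats0].
have step E1 c : inv E1 -> c \in rules E0 -> rule_applies a c E1 -> inv (c.2 :: E1).
  case=> ab old hc hr; split; first exact: abbreviates_step.
  move=> e y; rewrite in_cons => /orP[/eqP ->|]; last exact: old.
  by case/rulesP: hc => z [g [e1 [e2 [_ _ _ _ ->]]]] /=; case: (d_alpha D g).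
have [E [hE [ab old] closed]] := ev_saturate enc_state_inj hP DNil inv0 step.
have -> : `[< exists2 ws, epath es i ws t & word_val gen (flatten ws) = 1 >] =
    `[< vertex_query a E (i, [::]) (t, [::]) ([::] : seq (A v0)) >].
  apply/asboolP/asboolP => [[ws hp e1]|[ls [w [hp ew]]]].
    have [ls hls els] := expand_complete hp.
    apply: (saturated_complete ab closed old (epath_sub ab.1 hls)); rewrite els.
      exact: expand_typed.
    by rewrite -val_word_val e1 val1.
  rewrite word_val_nil => e1.
  have [ls' hp' e2] := abbreviates_path ab hp.
  have [ws hws e3] := expand_sound hp'; exists ws => //.
  apply: val_inj; rewrite val_word_val -[expand_word _]/([::] ++ _) -e3 e2 ew.
  by rewrite /lval letter_val_vertex e1 vincl1 val1.
apply: (ev_query enc_state_inj hP); try straight.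
apply: (@ev_comp _ _ _ (DCons (enc_E E)
  (DCons (enc_seq (enc_rule enc_state) (rules E0)) DNil))); last exact: ev_hd.
by apply: ev_comp hE; straight.
Qed.

End OneMembership.

(** * Reduction of membership to membership of the identity *)

(* The environments below hold a list of candidate words, the automaton, the
   word [m] and the description of the graph of groups. *)
Definition PFind one :=
  PFoldr
    (PIf (PComp one
            (PCons (PCons (PCons PNil (PCons (PCat (PVar 4) (PVar 0)) (PQuote (enc_nat 1)))) PNil)
               (PCons PNil (PCons (PQuote (enc_nat 1)) (PCons (PVar 5) PNil)))))
       (PCons (PVar 0) PNil) (PVar 1))
    PNil (PVar 0).

(** The candidates are all words of one length; a failure replaces them by the words one letter
    longer. *)
Definition PInverse one :=
  PWhile (PIf (PFind one) PNil PTrue)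
    (PCons
       (PFlatMap (PMap (PCons (PVar 2) (PVar 0)) (PVar 2)) (PIota (PGog 3 (PVar 3))))
       PTl).

(** From each terminal state an edge labelled by the inverse of [m] leads to a new state, numbered
    by the size of the automaton, which becomes the only terminal one. *)
Definition PMember one :=
  PLet (PComp PHd (PFind one))
    (PComp one
       (PCons (PCat (PComp PTl (PComp PTl (PComp PTl (PVar 2))))
                 (PMap (PCons (PVar 0) (PCons (PVar 2) (PComp PHd (PVar 4))))
                    (PComp PHd (PComp PTl (PComp PTl (PVar 2))))))
          (PCons (PComp PHd (PComp PTl (PVar 2)))
             (PCons (PComp PHd (PVar 2)) (PCons (PVar 4) PNil))))).

Definition PTop one :=
  PComp (PMember one) (PComp (PInverse one)
    (PCons (PQuote (DCons DNil DNil))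
       (PCons (PComp PHd PTl) (PCons (PComp PTl PTl) (PCons PHd PNil))))).

(** No edge leaves [n], so a path can enter it only with its last step. *)
Lemma epath_fresh (St L : eqType) (E : seq (St * L * St)) (T : seq St) (n : St) (l : L) p ws :
  (forall e, e \in E -> (e.1.1 != n) && (e.2 != n)) -> p != n -> n \notin T ->
  epath (E ++ [seq (t, l, n) | t <- T]) p ws n <->
  exists ws' t, [/\ t \in T, epath E p ws' t & ws = rcons ws' l].
Proof.
move=> hE pn hT; split; last first.
  case=> ws' [t [ht hp ->]]; rewrite -cats1; apply/epath_cat; exists t => /=.
    by apply: epath_sub hp => e he; rewrite mem_cat he.
  by exists n => //; rewrite mem_cat map_f ?orbT.
elim: ws p pn => [|w ws IH] p pn /=; first by move=> e; rewrite e eqxx in pn.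
case=> s; rewrite mem_cat => /orP[he|/mapP[t ht [-> -> ->]]].
  have /= /andP[_ sn] := hE _ he.
  by case/(IH _ sn)=> ws' [t [ht hp ->]]; exists (w :: ws'), t; split=> //; exists s.
case: ws {IH} => [_|w' ws] /=; first by exists [::], t.
case=> s'; rewrite mem_cat => /orP[/hE /=|/mapP[t' ht' [en _ _]]].
  by rewrite eqxx.
by rewrite -en in ht'; case/negP: hT.
Qed.

Section Membership.
Variables (M : monoidType) (S : finType) (gen : S -> M).
Hypothesis gen_generates : generates gen.
Hypothesis right_inv : forall x : M, exists y, x * y = 1.
Variables (gog : data) (one : prog).
Hypothesis gogS : data_nth 3 gog = enc_nat #|S|.
Hypothesis oneP : forall (es : seq (nat * seq S * nat)) i t env,
  eval one
    (DCons (enc_seq (@enc_sedge S) es) (DCons (enc_nat i) (DCons (enc_nat t) (DCons gog env))))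
    (enc_bool `[< exists2 ws, epath es i ws t & word_val gen (flatten ws) = 1 >]).

Let invb (m w : seq S) : bool := `[< word_val gen (m ++ w) = 1 >].

Definition find_inverse m (W : seq (seq S)) : seq (seq S) :=
  foldr (fun w acc => if invb m w then [:: w] else acc) [::] W.

Lemma ev_find (W : seq (seq S)) N (m : seq S) :
  eval (PFind one) (DCons (enc_seq (@enc_word S) W) (DCons N (DCons (enc_word m) (DCons gog DNil))))
    (enc_seq (@enc_word S) (find_inverse m W)).
Proof.
apply: (ev_foldr (encT := @enc_word S)); try straight.
move=> w acc; apply: (@ev_if _ _ _ _ (invb m w)).
(* The question whether [m ++ w] has value [1] is put to [one] as an automaton with a single edge
   from [0] to [1]. *)
- have -> : invb m w =
      `[< exists2 ws, epath [:: (0%N, m ++ w, 1%N)] 0%N ws 1%N & word_val gen (flatten ws) = 1 >].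
    apply/asboolP/asboolP => [h|[ws]].
      exists [:: m ++ w]; last by rewrite /= cats0.
      by exists 1%N; rewrite // mem_head.
    case: ws => [|w1 ws] //= [s]; rewrite in_cons orbF => /eqP[-> ->].
    by case: ws => [_|w2 ws [s'] //]; rewrite /= cats0.
  apply: ev_comp _ (oneP _ _ _ DNil); apply: ev_cons; last straight.
  apply: ev_cons; last straight.
  apply: ev_cons; first straight.
  apply: ev_cons; last straight.
  by apply: ev_cat; straight.
- by move=> ->; straight.
- by move=> /negbTE ->; straight.
Qed.

Fixpoint words n : seq (seq S) :=
  if n is k.+1 then flatten [seq [seq x :: w | w <- words k] | x <- enum S] else [:: [::]].

Lemma mem_words w : w \in words (size w).
Proof.
elim: w => [|x w IH] /=; first by rewrite mem_head.
by apply/flatten_mapP; exists x; rewrite ?mem_enum // map_f.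
Qed.

Lemma find_inverse_hd m W :
  find_inverse m W = [::] \/ exists2 w, find_inverse m W = [:: w] & invb m w.
Proof. by elim: W => [|w W IH] /=; [left | case: ifP => // hw; right; exists w]. Qed.

Lemma find_inverse_nil m W w : find_inverse m W = [::] -> w \in W -> ~~ invb m w.
Proof.
elim: W => //= x W IH; case: ifPn => // hx h; rewrite in_cons => /orP[/eqP -> //|].
exact: IH.
Qed.

(** Some word [w0] represents an inverse, so the search stops at length [size w0] at the latest. The
    initial [DCons DNil DNil] encodes the list containing just the empty word. *)
Lemma ev_inverse N (m : seq S) :
  exists W, (exists2 w, find_inverse m W = [:: w] & invb m w) /\
    let env := DCons N (DCons (enc_word m) (DCons gog DNil)) in
    eval (PInverse one) (DCons (DCons DNil DNil) env) (DCons (enc_seq (@enc_word S) W) env).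
Proof.
have [y hy] := right_inv (word_val gen m); have [w0 ew] := gen_generates y.
have hw : invb m w0 by apply/asboolP; rewrite word_val_cat -ew.
suff loop d k : (k + d = size w0)%N -> exists W,
    (exists2 w, find_inverse m W = [:: w] & invb m w) /\
    let env := DCons N (DCons (enc_word m) (DCons gog DNil)) in
    eval (PInverse one) (DCons (enc_seq (@enc_word S) (words k)) env)
      (DCons (enc_seq (@enc_word S) W) env).
  exact: (loop (size w0) 0%N).
elim: d k => [|d IH] k ek.
all: have [en|[w e1 hi]] := find_inverse_hd m (words k); last first.
1,3: exists (words k); split; first by exists w.
1,2: apply: ev_while_false; have := ev_find (words k) N m; rewrite e1 => h;
     exact: ev_if_true h (ev_quote _ _).
- have wk : w0 \in words k by rewrite -(addn0 k) ek mem_words.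
  by have := find_inverse_nil en wk; rewrite hw.
- have [W [hW ev]] := IH k.+1 (etrans (addSnnS _ _) ek); exists W; split=> //=.
  have := ev_find (words k) N m; rewrite en => h.
  apply: ev_while_true ev; first exact: ev_if_false h (ev_quote _ _).
  apply: ev_cons; last straight.
  apply: (ev_flatmap (encT := @enc_fin S)).
    by apply: ev_enum_card; apply: ev_straight => //; rewrite -gogS.
  move=> x acc; apply: (ev_map (encT := @enc_word S)); first straight.
  by move=> w acc'; straight.
Qed.

Lemma ev_top (N : automaton (seq S)) (m : seq S) :
  eval (PTop one) (DCons gog (DCons (enc_aut N) (enc_word m)))
    (enc_bool `[< recognised (map_aut (word_val gen) N) (word_val gen m) >]).
Proof.
have [W [[w ew /asboolP hw] /= hI]] := ev_inverse (enc_aut N) m.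
apply: ev_comp.
  by apply: ev_comp hI; straight.
have hf : eval (PComp PHd (PFind one))
    (DCons (enc_seq (@enc_word S) W)
       (DCons (enc_aut N) (DCons (enc_word m) (DCons gog DNil)))) (enc_word w).
  by have := ev_comp (ev_find W (enc_aut N) m) (ev_hd _); rewrite ew.
apply: ev_let hf _.
pose n := aut_size N.
pose E := [seq (val e.1.1, e.1.2, val e.2) | e <- aut_edges N].
pose T := [seq val t | t <- enum (aut_term N)].
(* Only right inverses are available: a right inverse [z] of the value of [w] cancels it from
   [x w = 1 = m w]. *)
have inv_r (x : M) : x * word_val gen w = 1 <-> x = word_val gen m.
  rewrite word_val_cat in hw; split=> [hx|-> //].
  have [z hz] := right_inv (word_val gen w).
  by rewrite -[x]mulg1 -hz mulgA hx mul1g -[LHS]mul1g -hw -mulgA hz mulg1.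
have pathE p ws (t : 'I_n) : epath E (val p) ws (val t) <-> epath (aut_edges N) p ws t.
  elim: ws p => [|l ws IH] p /=; first by split=> [/val_inj|->].
  split=> [[s /mapP[[[p' l'] s'] he [/val_inj -> -> ->]] /IH h]|[s he /IH h]].
    by exists s'.
  by exists (val s) => //; apply/mapP; exists (p, l, s).
have -> : `[< recognised (map_aut (word_val gen) N) (word_val gen m) >] =
    `[< exists2 ws, epath (E ++ [seq (t, w, n) | t <- T]) (aut_init N) ws n &
          word_val gen (flatten ws) = 1 >].
  have fresh ws : epath (E ++ [seq (t, w, n) | t <- T]) (aut_init N) ws n <->
      exists ws' t, [/\ t \in T, epath E (aut_init N) ws' t & ws = rcons ws' w].
    apply: epath_fresh.
    - by move=> e /mapP[e' _ ->]; rewrite !neq_ltn !ltn_ord.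
    - by rewrite neq_ltn ltn_ord.
    - by apply/negP => /mapP[t _ /eqP]; apply/negP; rewrite neq_ltn ltn_ord orbT.
  apply/asboolP/asboolP => 
      [/recognisedP[q [ls [hq hp em]]]|[ws /fresh[ls [t [ht hp ->]]] e1]].
    exists (rcons ls w).
      apply/fresh; exists ls, (val q); split=> //; last exact/pathE.
      by rewrite map_f // mem_enum.
    by rewrite flatten_rcons word_val_cat; apply/inv_r; rewrite em word_val_flatten.
  case/mapP: ht hp => q; rewrite mem_enum => hq -> /pathE hp.
  apply/recognisedP; exists q, ls; split=> //; rewrite -word_val_flatten.
  by apply/esym/inv_r; rewrite -word_val_cat -flatten_rcons.
apply: ev_comp _ (oneP _ _ _ DNil).
apply: ev_cons; last first.
  by apply: ev_straight => //; rewrite /= enc_fin_ord.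
apply: ev_cat.
  have -> : enc_seq (@enc_sedge S) E = enc_seq (fun e => DCons (enc_fin e.1.1)
       (DCons (enc_word e.1.2) (enc_fin e.2))) (aut_edges N).
    rewrite /E enc_seq_map; elim: (aut_edges N) => //= e es ->.
    by rewrite /enc_sedge /= !enc_fin_ord.
  straight.
have -> : [seq (t, w, n) | t <- T] = [seq (val t, w, n) | t <- enum (aut_term N)].
  by rewrite /T -map_comp.
apply: (ev_map (encT := @enc_fin 'I_n)); first straight.
by move=> t acc; apply: ev_straight => //; rewrite /= enc_fin_ord.
Qed.

End Membership.

(** * Construction of the decision programs *)

(** Merges the solvers of all vertices into the single program [h] used by the queries, by counting
    down the unary index of the vertex. *)
Fixpoint PDispatch (ps : seq prog) : prog :=
  if ps is p :: ps' then
    PIf PHd (PComp (PDispatch ps') (PCons (PComp PTl PHd) PTl)) (PComp p PTl)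
  else PId.

Lemma ev_dispatch (T : finType) (p : T -> prog) x d r :
  eval (p x) d r -> eval (PDispatch (map p (enum T))) (DCons (enc_fin x) d) r.
Proof.
move=> hx; have : nth x (enum T) (enum_rank x) = x by exact: nth_enum_rank.
have : (enum_rank x < size (enum T))%N by rewrite -cardE.
rewrite /enc_fin; move: (enum_rank x : nat) => n.
elim: n (enum T) => [|n IH] [|y s] //=.
  by move=> _ ->; apply: ev_if_false; [straight | apply: ev_comp hx; straight].
move=> hn ex; apply: (@ev_if_true _ _ _ _ DNil (enc_nat n)); first straight.
by apply: ev_comp (IH _ hn ex); straight.
Qed.

(** The closure lemmas below cover every constructor of [prog], so any fixed program text with holes
    filled by [p] qualifies. *)
Definition code_computable (f : prog -> prog) : Prop :=
  exists T, forall p, eval T (code p) (code (f p)).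

Lemma code_const q : code_computable (fun _ => q).
Proof. by exists (PQuote (code q)) => p; exact: ev_quote. Qed.

Lemma code_id : code_computable id.
Proof. by exists PId => p; exact: ev_id. Qed.

Lemma code_cons f g :
  code_computable f -> code_computable g -> code_computable (fun p => PCons (f p) (g p)).
Proof.
move=> [Tf hf] [Tg hg]; exists (PCons (PQuote (enc_nat 4)) (PCons Tf Tg)) => p.
exact: ev_cons (ev_quote _ _) (ev_cons (hf p) (hg p)).
Qed.

Lemma code_comp f g :
  code_computable f -> code_computable g -> code_computable (fun p => PComp (f p) (g p)).
Proof.
move=> [Tf hf] [Tg hg]; exists (PCons (PQuote (enc_nat 5)) (PCons Tf Tg)) => p.
exact: ev_cons (ev_quote _ _) (ev_cons (hf p) (hg p)).
Qed.

Lemma code_if b f g :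
  code_computable b -> code_computable f -> code_computable g ->
  code_computable (fun p => PIf (b p) (f p) (g p)).
Proof.
move=> [Tb hb] [Tf hf] [Tg hg].
exists (PCons (PQuote (enc_nat 6)) (PCons Tb (PCons Tf Tg))) => p.
exact: ev_cons (ev_quote _ _) (ev_cons (hb p) (ev_cons (hf p) (hg p))).
Qed.

Lemma code_while b f :
  code_computable b -> code_computable f -> code_computable (fun p => PWhile (b p) (f p)).
Proof.
move=> [Tb hb] [Tf hf]; exists (PCons (PQuote (enc_nat 7)) (PCons Tb Tf)) => p.
exact: ev_cons (ev_quote _ _) (ev_cons (hb p) (hf p)).
Qed.

Lemma code_top : code_computable (fun h => PTop (POne h)).
Proof.
rewrite /PTop /PMember /PInverse /PFind /POne /PSaturate /PMissing /PQuery /PQueryBody.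
rewrite /PFlatMap /PMap /PMem /PCat /PFoldr /PRev /PFoldl /PLet.
(* Trying [code_const] first quotes every subprogram free of [h] as a whole. *)
repeat first [apply: code_const | apply: code_id | apply: code_cons
  | apply: code_comp | apply: code_if | apply: code_while].
Qed.

Lemma code_dispatch : exists T, forall ps, eval T (enc_seq code ps) (code (PDispatch ps)).
Proof.
exists (PFoldr
  (PCons (PQuote (enc_nat 6)) (PCons (PQuote (code PHd))
     (PCons (PCons (PQuote (enc_nat 5))
               (PCons (PVar 1) (PQuote (code (PCons (PComp PTl PHd) PTl)))))
            (PCons (PQuote (enc_nat 5)) (PCons (PVar 0) (PQuote (code PTl)))))))
  (PQuote (code PId)) PId) => ps.
have -> : PDispatch ps = foldr (fun p q =>
    PIf PHd (PComp q (PCons (PComp PTl PHd) PTl)) (PComp p PTl)) PId ps by elim: ps.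
by apply: (ev_foldr (encT := code)) => [||p q]; straight.
Qed.

Definition PSubst :=
  let subst tbl w := PFlatMap (PLookup tbl (PVar 0)) w in
  PCons
    (PCons (PComp PHd (PVar 1))
      (PCons (PComp PHd (PComp PTl (PVar 1)))
        (PCons (PComp PHd (PComp PTl (PComp PTl (PVar 1))))
          (PMap
            (PCons (PComp PHd (PVar 0))
               (PCons (subst (PVar 4) (PComp PHd (PComp PTl (PVar 0))))
                      (PComp PTl (PComp PTl (PVar 0)))))
            (PComp PTl (PComp PTl (PComp PTl (PVar 1))))))))
    (subst (PVar 2) (PComp PTl PTl)).

Definition subst_word (A S : finType) (conj : A -> seq S) (w : seq A) : seq S :=
  flatten (map conj w).

Lemma ev_subst (A S : finType) (conj : A -> seq S) (N : automaton (seq A)) m :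
  eval PSubst
    (DCons (enc_seq (fun x => enc_word (conj x)) (enum A)) (DCons (enc_aut N) (enc_word m)))
    (DCons (enc_aut (map_aut (subst_word conj) N)) (enc_word (subst_word conj m))).
Proof.
apply: ev_cons; last first.
  apply: (ev_flatmap (encT := @enc_fin A)); first straight.
  move=> x acc; apply: (@ev_lookup A (fun x => enc_word (conj x))); straight.
do 3!(apply: ev_cons; first straight).
pose enc_e (T : finType) (e : 'I_(aut_size N) * seq T * 'I_(aut_size N)) : data :=
  DCons (enc_fin e.1.1) (DCons (enc_word e.1.2) (enc_fin e.2)).
apply: (@ev_map _ _ (enc_e A) (enc_e S) (fun e => (e.1.1, subst_word conj e.1.2, e.2))
  _ _ _ (aut_edges N)); first straight.
move=> e acc; apply: ev_cons; first straight.
apply: ev_cons; last straight.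
apply: (ev_flatmap (encT := @enc_fin A)); first straight.
move=> x acc'; apply: (@ev_lookup A (fun x => enc_word (conj x))); straight.
Qed.

(** * Words along edge paths and inverses in the fundamental group *)

Section EdgePaths.
Variables (Y : graph) (G : graph_of_groups Y) (X : vert Y -> choiceType).
Variable P : forall v : vert Y, monoid_pres (vgrp G v) (X v).

Lemma word_val_FGY u : word_val (letter_val P (fun v => mp_gen (P v))) u = FGY_class P u.
Proof.
elim: u => [|l u IH]; first by rewrite word_val_nil.
rewrite word_val_cons IH (FGY_class_cat P [:: l]); congr (_ * _).
by case: l => [y|[v x]] //=; rewrite -[mp_gen _ x]word_val1 -FGY_class_vertex.
Qed.

Lemma tgt_bar y : tgt (bar y) = src y :> vert Y.
Proof. by rewrite -src_bar. Qed.

Section EdgeWords.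
Variables (A : vert Y -> choiceType) (a : forall v, A v -> vgrp G v).

Lemma edge_word_typed u ys v :
  gpath u ys v -> typed_word u (map (@eletter Y A) ys) v.
Proof. by elim: ys u => //= y ys IH u /andP[-> /IH]. Qed.

Lemma edge_word_rev_typed u ys v :
  gpath u ys v -> typed_word v (map (@eletter Y A) (rev (map (@bar Y) ys))) u.
Proof.
elim: ys u => [|y ys IH] u /=; first by rewrite eq_sym.
case/andP=> /eqP <- /IH h; rewrite rev_cons map_rcons -cats1.
apply/typed_word_cat; exists (tgt y) => //=.
by rewrite src_bar barK tgt_bar !eqxx.
Qed.

Let wv := word_val (letter_val P a).

Lemma edge_word_val ys : wv (map (@eletter Y A) ys) = word_val (stable P) ys.
Proof. by rewrite /wv word_val_map. Qed.

End EdgeWords.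

Lemma edge_word_inv ys :
  word_val (stable P) ys * word_val (stable P) (rev (map (@bar Y) ys)) = 1 /\
  word_val (stable P) (rev (map (@bar Y) ys)) * word_val (stable P) ys = 1.
Proof.
elim: ys => [|y ys [IH1 IH2]] /=; first by rewrite !word_val_nil mulg1.
rewrite rev_cons -cats1 word_val_cat word_val1 word_val_cons; split.
  by rewrite -mulgA [X in _ * X]mulgA IH1 mul1g stableK.
by rewrite -mulgA [X in _ * X]mulgA -{2}(barK y) stableK mul1g IH2.
Qed.

Lemma typed_in_pi1 v0 (w : seq (letter X)) :
  typed_word v0 w v0 -> in_pi1 P v0 (FGY_class P w).
Proof. by move=> h; apply/asboolP; exists w => //; exact: typed_cycle_type. Qed.

Lemma in_pi1_typed v0 f :
  in_pi1 P v0 f -> exists2 w, typed_word v0 w v0 & f = FGY_class P w.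
Proof. by move/asboolP=> [w /cycle_type_typed h ->]; exists w. Qed.

(** The word is reversed and each letter replaced by one for its inverse: [bar y] for an edge, a
    word over the same vertex generators otherwise. *)
Lemma typed_word_inv u (w : seq (letter X)) v :
  typed_word u w v ->
  exists2 w', typed_word v w' u & FGY_class P w * FGY_class P w' = 1.
Proof.
elim: w u => [|l w IH] u.
  by move=> /= h; exists [::]; [rewrite /= eq_sym | rewrite -FGY_class_cat].
rewrite (FGY_class_cat P [:: l]); case: l => [y|[z x]] /= /andP[/eqP <- /IH[w' h e]].
  exists (w' ++ [:: inl (bar y)]).
    by apply/typed_word_cat; exists (tgt y) => //=; rewrite src_bar barK tgt_bar !eqxx.
  rewrite FGY_class_cat -mulgA [X in _ * X]mulgA e mul1g; exact: stableK.
have [o eo] := mp_generates (P z) (mp_gen (P z) x)^-1.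
exists (w' ++ map (@vletter Y X z) o).
  by apply/typed_word_cat; exists z => //=; rewrite typed_word_vertex !eqxx orbT.
rewrite FGY_class_cat -mulgA [X in _ * X]mulgA e mul1g.
rewrite (FGY_class_vertex P [:: x]) FGY_class_vertex -eo word_val1 -vinclM mulgV.
exact: vincl1.
Qed.

Lemma pi1_right_inv v0 (x : pi1 P v0) : exists y, x * y = 1.
Proof.
have [w hw ew] := in_pi1_typed (valP x).
have [w' hw' e] := typed_word_inv hw.
exists (Sub (FGY_class P w') (typed_in_pi1 hw')).
by apply: val_inj; rewrite valM val1 ew SubK.
Qed.

End EdgePaths.

Section Solvers.
Variables (Y : graph) (G : graph_of_groups Y) (X : vert Y -> choiceType).
Variable P : forall v : vert Y, monoid_pres (vgrp G v) (X v).
Variables (v0 : vert Y) (S : finType) (gen : S -> pi1 P v0).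
Hypothesis gen_generates : generates gen.

Definition pi1_solver (gog : data) (h : prog) : prog :=
  PComp (PTop (POne h)) (PCons (PQuote gog) PId).

Lemma pi1_solverP (A : vert Y -> finType) (a : forall v, A v -> vgrp G v)
    (D : gog_data G A S) (p : vert Y -> prog) :
  (forall y g, word_val (@a (src y)) (d_alpha D g) = alpha G y g) ->
  (forall y g, word_val (@a (tgt y)) (d_omega D g) = omega G y g) ->
  (forall s, typed_word v0 (d_gen D s) v0) ->
  (forall s, val (gen s) = word_val (letter_val P a) (d_gen D s)) ->
  (forall v, solves_RSP (@a v) (p v)) ->
  solves_RSP gen (pi1_solver (enc_gog v0 D) (PDispatch (map p (enum (vert Y))))).
Proof.
move=> alphaP omegaP gen_typed genP hp N m.
have hP v (N' : automaton (seq (A v))) (m' : seq (A v)) : exists b : bool,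
  eval (PDispatch (map p (enum (vert Y))))
    (DCons (enc_fin v) (DCons (enc_aut N') (enc_word m'))) (enc_bool b) /\
  (b <-> recognised (map_aut (word_val (@a v)) N') (word_val (@a v) m')).
  by have [b [hb eb]] := hp v N' m'; exists b; split=> //; exact: ev_dispatch.
exists `[< recognised (map_aut (word_val gen) N) (word_val gen m) >].
split; last by split=> /asboolP.
apply: ev_comp (ev_cons (ev_quote _ _) (ev_id _)) _.
apply: (ev_top gen_generates (@pi1_right_inv _ _ _ P v0)) => // es i t env.
exact: (ev_one alphaP omegaP gen_typed genP hP).
Qed.

Definition vertex_solver (tbl : data) (q : prog) : prog :=
  PComp q (PComp PSubst (PCons (PQuote tbl) PId)).

(* Conjugation by [T] embeds the vertex group into the fundamental group. *)
Lemma vertex_solverP v (A : finType) (a : A -> vgrp G v) (conj : A -> seq S)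
    (T T' : FGY P) (q : prog) :
  T * T' = 1 -> T' * T = 1 ->
  (forall x, val (word_val gen (conj x)) = T * vincl P (a x) * T') ->
  solves_RSP gen q ->
  solves_RSP a (vertex_solver (enc_seq (fun x => enc_word (conj x)) (enum A)) q).
Proof.
move=> TT' T'T hconj hq N m.
have [b [hb eb]] := hq (map_aut (subst_word conj) N) (subst_word conj m).
exists b; split.
  apply: ev_comp _ hb; apply: ev_comp (ev_subst conj N m).
  exact: ev_cons (ev_quote _ _) (ev_id _).
have sval w : val (word_val gen (subst_word conj w)) = T * vincl P (word_val a w) * T'.
  elim: w => [|x w IH]; first by rewrite !word_val_nil vincl1 mulg1 TT' val1.
  rewrite -[subst_word _ _]/(conj x ++ subst_word conj w)
    word_val_cat valM IH hconj word_val_cons.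
  by rewrite vinclM -!mulgA (mulgA T' T) T'T mul1g.
have sinj w1 w2 : word_val gen (subst_word conj w1) = word_val gen (subst_word conj w2) <->
    word_val a w1 = word_val a w2.
  split=> [/(congr1 val)|e]; last by apply: val_inj; rewrite !sval e.
  rewrite !sval => /(congr1 (fun f => T' * f * T)).
  by rewrite -!mulgA T'T !mulg1 !(mulgA T' T) T'T !mul1g => /(@vincl_inj _ _ _ P).
rewrite eb; have -> : map_aut (word_val gen) (map_aut (subst_word conj) N) =
    map_aut (word_val gen \o subst_word conj) N.
  by rewrite /map_aut /= -map_comp.
have sflat ls : word_val (word_val gen \o subst_word conj) ls =
    word_val gen (subst_word conj (flatten ls)).
  elim: ls => [|l ls IH]; first by rewrite !word_val_nil.
  by rewrite word_val_cons IH /subst_word /= map_cat flatten_cat word_val_cat.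
rewrite !recognisedP; split=> -[t [ls [ht hl e]]]; exists t, ls; split=> //.
  by rewrite -word_val_flatten; apply/sinj; rewrite e sflat.
by rewrite sflat; apply/sinj; rewrite word_val_flatten.
Qed.

End Solvers.

(** * A finite generating set of the fundamental group *)

Section FiniteGeneration.
Variables (Y : graph) (G : graph_of_groups Y) (X : vert Y -> choiceType).
Variable P : forall v : vert Y, monoid_pres (vgrp G v) (X v).
Variables (A : vert Y -> finType) (a : forall v, A v -> vgrp G v).
Variable v0 : vert Y.
Hypothesis a_generates : forall v, generates (@a v).
Variable pth : vert Y -> seq (edge Y).
Hypothesis pthP : forall v, gpath v0 (pth v) v.

Let wv := word_val (letter_val P a).

Lemma letter_word (u v : vert Y) (w : seq (letter A)) :
  typed_word u w v -> exists2 w' : seq (letter X), typed_word u w' v & FGY_class P w' = wv w.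
Proof.
elim: w u => [|l w IH] u; first by exists [::] => //; rewrite /wv word_val_nil.
rewrite /wv word_val_cons; case: l => [y|[z x]] /= /andP[/eqP <- /IH[w' h e]].
  exists (inl y :: w'); first by rewrite /= eqxx.
  by rewrite (FGY_class_cat P [:: inl y]) e.
have [o eo] := mp_generates (P z) (a x).
exists (map (@vletter Y X z) o ++ w').
  by apply/typed_word_cat; exists z => //; rewrite typed_word_vertex !eqxx orbT.
by rewrite FGY_class_cat FGY_class_vertex -eo e.
Qed.

Definition pi1_letter : finType := (edge Y + {v : vert Y & A v})%type.

Definition lsrc (l : letter A) : vert Y :=
  match l with inl y => src y | inr (existT v _) => v end.
Definition ltgt (l : letter A) : vert Y :=
  match l with inl y => tgt y | inr (existT v _) => v end.

Definition path_word v : seq (letter A) := map (@eletter Y A) (pth v).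
Definition path_word_rev v : seq (letter A) := map (@eletter Y A) (rev (map (@bar Y) (pth v))).

Definition pi1_word (l : letter A) : seq (letter A) :=
  path_word (lsrc l) ++ l :: path_word_rev (ltgt l).

Lemma pi1_word_typed l : typed_word v0 (pi1_word l) v0.
Proof.
apply/typed_word_cat; exists (lsrc l); first by apply: edge_word_typed; exact: pthP.
by case: l => [y|[v x]] /=; rewrite eqxx /=; apply: edge_word_rev_typed; exact: pthP.
Qed.

Lemma pi1_gen_exists l : exists x : pi1 P v0, val x = wv (pi1_word l).
Proof.
have [w hw <-] := letter_word (pi1_word_typed l).
by exists (Sub (FGY_class P w) (typed_in_pi1 P hw)); rewrite SubK.
Qed.

Definition pi1_gen (l : pi1_letter) : pi1 P v0 := projT1 (cid (pi1_gen_exists l)).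

Lemma pi1_genE (l : pi1_letter) : val (pi1_gen l) = wv (pi1_word l).
Proof. exact: projT2 (cid (pi1_gen_exists l)). Qed.

(** In a product of the loops attached to consecutive letters of a typed word, each return path
    cancels the next outgoing path, leaving the word between the paths of its two ends. *)
Lemma pi1_gen_generates : generates pi1_gen.
Proof.
pose T v := wv (path_word v); pose T' v := wv (path_word_rev v).
have TT v : T v * T' v = 1.
  by rewrite /T /T' /wv !edge_word_val; exact: (edge_word_inv P (pth v)).1.
have TT' v : T' v * T v = 1.
  by rewrite /T /T' /wv !edge_word_val; exact: (edge_word_inv P (pth v)).2.
have genE (l : pi1_letter) : val (pi1_gen l) = T (lsrc l) * letter_val P a l * T' (ltgt l).
  by rewrite pi1_genE /wv /pi1_word word_val_cat word_val_cons mulgA.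
have join (x y : FGY P) v : T v * (x * T' v) * (T v * y) = T v * (x * y).
  by rewrite -!mulgA (mulgA (T' v)) TT' mul1g.
have vgen v (w : seq (A v)) : exists s, val (word_val pi1_gen s) =
    T v * vincl P (word_val (@a v) w) * T' v.
  elim: w => [|x w [s es]].
    by exists [::]; rewrite !word_val_nil vincl1 mulg1 TT val1.
  exists ((inr (existT _ v x) : pi1_letter) :: s); rewrite !word_val_cons valM es genE /=.
  by rewrite vinclM -!mulgA (mulgA (T' v)) TT' mul1g.
have wgen u v (w : seq (letter X)) : typed_word u w v -> exists s,
    val (word_val pi1_gen s) = T u * FGY_class P w * T' v.
  elim: w u => [|l w IH] u.
    move/eqP=> ->; exists [::]; rewrite word_val_nil val1.
    by rewrite -[FGY_class P _]/(1 : FGY P) mulg1 TT.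
  rewrite (FGY_class_cat P [:: l]); case: l => [y|[z x]] /andP[/eqP <- /IH[s es]].
    exists ((inl y : pi1_letter) :: s); rewrite word_val_cons valM es genE /=.
    by rewrite -!mulgA (mulgA (T' _)) TT' mul1g.
  have [w' ew'] := a_generates (mp_gen (P z) x).
  have [s' es'] := vgen z w'.
  exists (s' ++ s); rewrite word_val_cat valM es es' -ew'.
  rewrite (FGY_class_vertex P [:: x]) word_val1.
  by rewrite -!mulgA (mulgA (T' _)) TT' mul1g.
move=> f; have [w hw ew] := in_pi1_typed (valP f).
(* The chosen path from [v0] to itself need not be empty; conjugating [w] first compensates for the
   factors [T v0] and [T' v0] introduced by [wgen]. *)
pose e := map (@eletter Y X) (rev (map (@bar Y) (pth v0))) ++ w ++ map (@eletter Y X) (pth v0).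
have he : typed_word v0 e v0.
  apply/typed_word_cat; exists v0; first by apply: edge_word_rev_typed; exact: pthP.
  apply/typed_word_cat; exists v0 => //; apply: edge_word_typed; exact: pthP.
have [s es] := wgen _ _ _ he; exists s; apply: val_inj; rewrite es /e !FGY_class_cat -ew.
have eX ys : FGY_class P (map (@eletter Y X) ys) = word_val (stable P) ys.
  by rewrite -word_val_FGY edge_word_val.
have eA ys : wv (map (@eletter Y A) ys) = word_val (stable P) ys.
  by rewrite /wv edge_word_val.
rewrite /T /T' !eX /path_word /path_word_rev !eA.
have [i1 i2] := edge_word_inv P (pth v0).
by rewrite -!mulgA i1 mulg1 mulgA i1 mul1g.
Qed.

End FiniteGeneration.

Lemma decidable_pi1 (Y : graph) (G : graph_of_groups Y) (X : vert Y -> choiceType)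
    (P : forall v : vert Y, monoid_pres (vgrp G v) (X v)) (v0 : vert Y) :
  connected Y -> (forall v : vert Y, decidable_RSP (vgrp G v)) -> decidable_RSP (pi1 P v0).
Proof.
move=> conn dec.
have /choice[pth pthP] : forall v, exists ys, gpath v0 ys v by move=> v; exact: conn.
have /choice[A hA] : forall v, exists A : finType, exists gen : A -> vgrp G v,
    generates gen /\ exists p, solves_RSP gen p by exact: dec.
pose a v : A v -> vgrp G v := projT1 (cid (hA v)).
have a_gen v : generates (@a v) by exact: (projT2 (cid (hA v))).1.
have /choice[p hp] : forall v, exists p, solves_RSP (@a v) p.
  by move=> v; exact: (projT2 (cid (hA v))).2.
pose gal y (g : egrp G y) := projT1 (cid (a_gen (src y) (alpha G y g))).
pose gom y (g : egrp G y) := projT1 (cid (a_gen (tgt y) (omega G y g))).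
pose D : gog_data G A (pi1_letter A) := {|
  d_alpha := gal; d_omega := gom;
  d_gen := fun l => pi1_word pth (l : letter A);
  d_path := pth; d_conj := fun _ _ => [::] |}.
exists (pi1_letter A), (pi1_gen P a pthP); split; first exact: pi1_gen_generates.
eexists; apply: (@pi1_solverP _ _ _ P v0 _ _ _ A a D p) => //.
- exact: pi1_gen_generates.
- by move=> y g; rewrite -(projT2 (cid (a_gen (src y) (alpha G y g)))).
- by move=> y g; rewrite -(projT2 (cid (a_gen (tgt y) (omega G y g)))).
- by move=> l; exact: pi1_word_typed.
- by move=> l; exact: pi1_genE.
Qed.

Lemma decidable_vertex (Y : graph) (G : graph_of_groups Y) (X : vert Y -> choiceType)
    (P : forall v : vert Y, monoid_pres (vgrp G v) (X v)) (v0 v : vert Y) :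
  connected Y -> finitely_generated (vgrp G v) -> decidable_RSP (pi1 P v0) ->
  decidable_RSP (vgrp G v).
Proof.
move=> conn [A [a a_gen]] [S [gen [gen_gen [q hq]]]].
have [ys hys] := conn v0 v.
pose T := word_val (stable P) ys; pose T' := word_val (stable P) (rev (map (@bar Y) ys)).
have [TT TT'] := edge_word_inv P ys.
have eX zs : FGY_class P (map (@eletter Y X) zs) = word_val (stable P) zs.
  by rewrite -word_val_FGY edge_word_val.
have /choice[conj hconj] : forall x, exists s, val (word_val gen s) = T * vincl P (a x) * T'.
  move=> x; have [w ew] := mp_generates (P v) (a x).
  have hw : typed_word v0 (map (@eletter Y X) ys ++ map (@vletter Y X v) w ++
      map (@eletter Y X) (rev (map (@bar Y) ys))) v0.
    apply/typed_word_cat; exists v; first exact: edge_word_typed.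
    apply/typed_word_cat; exists v; first by rewrite typed_word_vertex !eqxx orbT.
    exact: edge_word_rev_typed.
  have [s es] := gen_gen (Sub _ (typed_in_pi1 P hw)).
  by exists s; rewrite -es SubK !FGY_class_cat !eX FGY_class_vertex -ew mulgA.
exists A, a; split=> //; eexists; exact: vertex_solverP TT TT' hconj hq.
Qed.

Theorem theorem5p1 :
  (forall (Y : graph) (G : graph_of_groups Y) (X : vert Y -> choiceType)
      (P : forall v : vert Y, monoid_pres (vgrp G v) (X v)) (v0 : vert Y),
    connected Y ->
    (forall v : vert Y, finitely_generated (vgrp G v)) ->
    (decidable_RSP (pi1 P v0) <-> forall v : vert Y, decidable_RSP (vgrp G v)))
  /\
  (exists T : prog,
    forall (Y : graph) (G : graph_of_groups Y) (A : vert Y -> finType)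
      (P : forall v : vert Y, monoid_pres (vgrp G v) (A v)) (v0 : vert Y)
      (S : finType) (gen : S -> pi1 P v0) (D : gog_data G A S) (p : vert Y -> prog),
    connected Y ->
    generates gen ->
    describes gen D ->
    (forall v : vert Y, solves_RSP (mp_gen (P v)) (p v)) ->
    exists q : prog,
      eval T (DCons (enc_gog v0 D) (enc_progs p)) (code q) /\ solves_RSP gen q)
  /\
  (exists T : prog,
    forall (Y : graph) (G : graph_of_groups Y) (A : vert Y -> finType)
      (P : forall v : vert Y, monoid_pres (vgrp G v) (A v)) (v0 : vert Y)
      (S : finType) (gen : S -> pi1 P v0) (D : gog_data G A S) (q : prog),
    connected Y ->
    generates gen ->
    describes gen D ->
    solves_RSP gen q ->
    exists p : vert Y -> prog,
      eval T (DCons (enc_gog v0 D) (code q)) (enc_progs p) /\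
      forall v : vert Y, solves_RSP (mp_gen (P v)) (p v)).
Proof.
split; first by move=> Y G X P v0 conn fg; split=> [dec v|];
  [exact: decidable_vertex dec | exact: decidable_pi1].
have [Ttop htop] := code_top; have [Tdisp hdisp] := code_dispatch.
split.
  (* The numerals are constructor tags of [code]: the output is the code of [pi1_solver], with the
     description of the graph of groups inserted as a quoted constant. *)
  exists (PCons (PQuote (enc_nat 5)) (PCons (PComp Ttop (PComp Tdisp PTl))
    (PCons (PQuote (enc_nat 4)) (PCons (PCons (PQuote (enc_nat 1)) PHd) (PQuote (code PId)))))).
  move=> Y G A P v0 S gen D p conn gen_gen desc hp.
  exists (pi1_solver (enc_gog v0 D) (PDispatch (map p (enum (vert Y))))); split.
    apply: ev_cons (ev_quote _ _) _; apply: ev_cons; last straight.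
    apply: ev_comp (htop _); apply: ev_comp (hdisp _).
    by apply: ev_straight => //; rewrite /= /enc_progs enc_seq_map.
  case: desc => dal dom dcyc dgen dpath dconj.
  apply: (pi1_solverP gen_gen (a := fun v => mp_gen (P v))) => //.
  - by move=> s; exact: cycle_type_typed.
  - by move=> s; rewrite dgen word_val_FGY.
(* Component [7] holds the table of [d_conj] for each vertex. In the body of the map two entries
   precede the input pair, so [PSkip 3] is the second half of that pair, the code of [q]. *)
exists (PMap (PCons (PQuote (enc_nat 5)) (PCons (PSkip 3)
    (PCons (PQuote (enc_nat 5)) (PCons (PQuote (code PSubst))
       (PCons (PQuote (enc_nat 4)) (PCons (PCons (PQuote (enc_nat 1)) (PVar 0))
          (PQuote (code PId))))))))
  (PGog 7 PHd)).
move=> Y G A P v0 S gen D q conn gen_gen desc hq.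
pose tbl v := enc_seq (fun x => enc_word (d_conj D (v := v) x)) (enum (A v)).
exists (fun v => vertex_solver (tbl v) q); split.
  rewrite /enc_progs -[enum (vert Y)]map_id.
  apply: (ev_map (encT := tbl)); first straight.
  by move=> v acc; straight.
case: desc => dal dom dcyc dgen dpath dconj v.
have [TT TT'] := edge_word_inv P (d_path D v).
have eX ys : FGY_class P (map (@eletter Y _) ys) = word_val (stable P) ys.
  by rewrite -word_val_FGY edge_word_val.
apply: (vertex_solverP TT TT') hq => x.
rewrite dconj FGY_class_cat (FGY_class_cat P [:: _]) !eX.
by rewrite (FGY_class_vertex P [:: x]) word_val1 mulgA.
Qed.
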